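(* Let $0<q<1$, $a\in\mathbb{R}$ and $t=q^a-q^{-a}$. Up to unitary equivalence, all the $SL(2,\mathbb{R})_t$-admissible irreducible $*$-representations of $U_q(\mathfrak{sl}(2,\mathbb{R})_t)$ are the following, all of them being mutually non-equivalent: (1) the modules $\mathscr{L}_\lambda^+=L_{\lambda,a}$ with $-(q^{1-2s}+q^{2s-1})<\lambda<q^{-1}+q$, where $s\in[0,1)$ and $a+s\in\mathbb{Z}$; (2) the modules $\mathscr{L}_\lambda^-=L_{\lambda,a-1}$ with $-(q^{1-2s}+q^{2s-1})<\lambda<2$, where $s\in[0,1)$ and $a+s\in\frac12+\mathbb{Z}$; (3) the modules $\mathscr{D}_n^+=L_{\{n-1\},a+n}$ for $n\in\mathbb{Z}_{>0}$; (4) the modules $\mathscr{E}_n^+=L_{-\{2a+n-1\},a+n}$ for $n\in\mathbb{Z}$ with $n>-2a$; (5) the modules $\mathscr{D}_n^-=L_{\{n-1\},a-n}$ for $n\in\mathbb{Z}_{>0}$; (6) the modules $\mathscr{E}_n^-=L_{-\{-2a+n-1\},a-n}$ for $n\in\mathbb{Z}$ with $n>2a$; (7) the trivial module $\mathscr{I}=L_{q^{-1}+q,a}$; (8) the one-dimensional module $\mathscr{C}=L_{-(q^{-1}+q),-a}$ if $a\in\frac12\mathbb{Z}$.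
   Context: Notation: for $x\in\mathbb{R}$, $[x]=\frac{q^{-x}-q^{x}}{q^{-1}-q}$ and $\{x\}=q^x+q^{-x}$. The $*$-algebra. $U_q(\mathfrak{sl}(2,\mathbb{R})_t)$ is the universal unital $*$-algebra over $\mathbb{C}$ generated by $X_t,Y_t,Z_t,B_t$ with $X_t^*=Y_t$, $Z_t^*=Z_t$, $B_t^*=-B_t$ and $X_tZ_t=q^2Z_tX_t$, $Y_tZ_t=q^{-2}Z_tY_t$, $X_tY_t=1-qtZ_t-q^2Z_t^2$, $Y_tX_t=1-q^{-1}tZ_t-q^{-2}Z_t^2$, $B_tX_t=q^2X_tB_t+q((q+q^{-1})Z_t+t)$, $B_tY_t=q^{-2}Y_tB_t+q^{-1}((q+q^{-1})Z_t+t)$, $B_tZ_t=Z_tB_t-(X_t+Y_t)$. Let $U_q(\mathfrak{m}_t)$ be the subalgebra generated by $X_t,Y_t,Z_t$ and $U_q(\mathfrak{k}_t)=\mathbb{C}[B_t]$ the (polynomial) subalgebra generated by $B_t$; multiplication $U_q(\mathfrak{m}_t)\otimes U_q(\mathfrak{k}_t)\to U_q(\mathfrak{sl}(2,\mathbb{R})_t)$ is a linear bijection. For $c\in\mathbb{R}$ put $T_c^+=iq^cX_t-(q+q^{-1})Z_t+iq^{-c}Y_t-t$, $T_c^-=-iq^{-c}X_t-(q+q^{-1})Z_t-iq^{c}Y_t-t$, $A_c=iq^{-1}X_t+(q^c-q^{-c})Z_t-iqY_t$, and for integers $n\ge 0$, $T_c^{+,(n)}=T^+_{c+2n-2}\cdots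 T^+_{c+2}T^+_c$, $T_c^{-,(n)}=T^-_{c-2n+2}\cdots T^-_{c-2}T^-_c$ (equal to $1$ for $n=0$). Admissibility. A $U_q(\mathfrak{sl}(2,\mathbb{R})_t)$-module $(V,\pi)$ is $\widetilde{SL}(2,\mathbb{R})$-admissible if $\pi(iB_t)$ is diagonalizable with finite-dimensional eigenspaces. If $V$ is moreover a pre-Hilbert space and $\langle\xi,\pi(x)\eta\rangle=\langle\pi(x^* )\xi,\eta\rangle$ for all $\xi,\eta\in V$ and all $x$, it is an $\widetilde{SL}(2,\mathbb{R})$-admissible $*$-representation ($X_t,Y_t,Z_t$ then automatically act by bounded operators). It is $SL(2,\mathbb{R})_t$-admissible if in addition all eigenvalues of $\pi(iB_t)$ are of the form $[c]$ with $c\in a+\mathbb{Z}$. The modules $L_{\lambda,b}$. For $\lambda,b\in\mathbb{R}$ let $\mathbb{C}_b$ be the one-dimensional $U_q(\mathfrak{k}_t)$-module on which $iB_t$ acts by $[b]$. Identify $U_q(\mathfrak{sl}(2,\mathbb{R})_t)\otimes_{U_q(\mathfrak{k}_t)}\mathbb{C}_b\cong U_q(\mathfrak{m}_t)$ as vector spaces. The left ideal $I_{\lambda,b}=U_q(\mathfrak{m}_t)(A_b-\lambda)$ is a $U_q(\mathfrak{sl}(2,\mathbb{R})_t)$-submodule, and $M_{\lambda,b}=U_q(\mathfrak{m}_t)/I_{\lambda,b}$. With $\widehat 1$ the class of $1$, put $e_{b+2n}=T_b^{+,(n)}\widehat1$ and $e_{b-2n}=T_b^{-,(n)}\widehat1$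 for $n\ge0$; the $e_c$, $c\in b+2\mathbb{Z}$, form a basis of $M_{\lambda,b}$, and $e_c$ is an $iB_t$-eigenvector at eigenvalue $[c]$. There is a unique sesquilinear form on $M_{\lambda,b}$ which is $*$-invariant ($\langle\xi,x\eta\rangle=\langle x^*\xi,\eta\rangle$) and has $\langle e_b,e_b\rangle=1$; its kernel $N_{\lambda,b}$ is a submodule, and $L_{\lambda,b}=M_{\lambda,b}/N_{\lambda,b}$ with the induced non-degenerate $*$-invariant form. *)

(* Defs.v *)
From HB Require Import structures.
From mathcomp Require Import all_boot all_order all_algebra.
From mathcomp Require Import complex ring lra.
From mathcomp Require Import all_classical all_reals all_analysis.

Set Implicit Arguments.
Unset Strict Implicit.
Unset Printing Implicit Defensive.

Import Order.TTheory GRing.Theory Num.Theory.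

Local Open Scope ring_scope.
Local Open Scope complex_scope.
Local Open Scope quotient_scope.

Section QuotientSpace.
Context {K : pzRingType} {V : lmodType K}.

Definition in_sub (W : submodClosed V) : pred V := fun x => x \in W.

Fact in_sub_zmod_closed (W : submodClosed V) : zmod_closed (in_sub W).
Proof.
split=> [|x y Wx Wy]; first exact: rpred0.
by apply: rpredD => //; rewrite -scaleN1r; exact: rpredZ.
Qed.

HB.instance Definition _ (W : submodClosed V) :=
  GRing.isZmodClosed.Build V (in_sub W) (in_sub_zmod_closed W).

Definition sub_zmod (W : submodClosed V) : zmodClosed V :=
  GRing.ZmodClosed.clone V (in_sub W) _.

Definition vquot (W : submodClosed V) : Type := {ideal_quot sub_zmod W}.

Variable W : submodClosed V.

HB.instance Definition _ := GRing.Zmodule.on (vquot W).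
HB.instance Definition _ : EqQuotient V (Quotient.equiv (sub_zmod W)) (vquot W) :=
  EqQuotient.on (vquot W).

Lemma vquotP (x y : V) : reflect (\pi_(vquot W) x = \pi_(vquot W) y) (x - y \in W).
Proof.
by rewrite -[_ \in W]/(x - y \in sub_zmod W) Quotient.idealrBE; exact: eqP.
Qed.

Lemma vquotD (x y : V) : \pi_(vquot W) (x + y) = \pi_(vquot W) x + \pi_(vquot W) y.
Proof. exact: Quotient.pi_add. Qed.

Lemma vquot0 : \pi_(vquot W) 0 = 0.
Proof. by apply: (addIr (\pi_(vquot W) 0)); rewrite -vquotD addr0 add0r. Qed.

Definition vquot_scale (a : K) (x : vquot W) : vquot W := \pi_(vquot W) (a *: repr x).

Lemma vquotZ a (x : V) : \pi_(vquot W) (a *: x) = vquot_scale a (\pi x).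
Proof.
apply/vquotP; rewrite -scalerBr rpredZ //; apply/vquotP.
by rewrite reprK.
Qed.

Fact vquot_scaleA a b x :
  vquot_scale a (vquot_scale b x) = vquot_scale (a * b) x.
Proof. by rewrite -[x]reprK -!vquotZ scalerA. Qed.

Fact vquot_scale1 : left_id 1 vquot_scale.
Proof. by move=> x; rewrite -[x]reprK -!vquotZ scale1r. Qed.

Fact vquot_scaleDr : right_distributive vquot_scale +%R.
Proof.
move=> a x y; rewrite -[x]reprK -[y]reprK -vquotD -!vquotZ.
by rewrite scalerDr vquotD.
Qed.

Fact vquot_scaleDl x : {morph vquot_scale^~ x : a b / a + b}.
Proof. by move=> a b; rewrite -[x]reprK -!vquotZ scalerDl vquotD. Qed.

HB.instance Definition _ := GRing.Zmodule_isLmodule.Build K (vquot W)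
  vquot_scaleA vquot_scale1 vquot_scaleDr vquot_scaleDl.

End QuotientSpace.

Variant generator := gX | gY | gZ | gB.

Inductive term (R : realType) : Type :=
| Gen of generator
| Const of R[i]
| Add of term R & term R
| Mul of term R & term R
| Star of term R.
Arguments Gen {R}.

HB.instance Definition _ (R : realType) := gen_eqMixin (term R).
HB.instance Definition _ (R : realType) := gen_choiceMixin (term R).

Declare Scope term_scope.
Delimit Scope term_scope with T.
Local Notation "x + y" := (Add x y) : term_scope.
Local Notation "x * y" := (Mul x y) : term_scope.
Local Notation "c *: x" := (Mul (Const c%R) x) : term_scope.
Local Notation "- x" := (Mul (Const (-1)%R) x) : term_scope.
Local Notation "x - y" := (Add x (- y)%T) : term_scope.
Local Notation "1" := (Const 1%R) : term_scope.
Local Notation X := (Gen gX).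
Local Notation Y := (Gen gY).
Local Notation Z := (Gen gZ).
Local Notation B := (Gen gB).

Local Open Scope term_scope.

(* The smallest congruence on words containing the axioms of unital complex
   *-algebras and the defining relations; the quotient is the universal unital
   *-algebra on these generators and relations. *)
Inductive Ueq (R : realType) (q t : R) : term R -> term R -> Prop :=
| Ueq_refl x : Ueq q t x x
| Ueq_sym x y : Ueq q t x y -> Ueq q t y x
| Ueq_trans x y z : Ueq q t x y -> Ueq q t y z -> Ueq q t x z
| Ueq_add x x' y y' : Ueq q t x x' -> Ueq q t y y' -> Ueq q t (x + y) (x' + y')
| Ueq_mul x x' y y' : Ueq q t x x' -> Ueq q t y y' -> Ueq q t (x * y) (x' * y')
| Ueq_star x x' : Ueq q t x x' -> Ueq q t (Star x) (Star x')
| Ueq_addA x y z : Ueq q t (x + (y + z)) (x + y + z)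
| Ueq_addC x y : Ueq q t (x + y) (y + x)
| Ueq_add0 x : Ueq q t (Const 0%R + x) x
| Ueq_addN x : Ueq q t (- x + x) (Const 0%R)
| Ueq_mulA x y z : Ueq q t (x * (y * z)) (x * y * z)
| Ueq_mul1 x : Ueq q t (1 * x) x
| Ueq_mulDl x y z : Ueq q t ((x + y) * z) (x * z + y * z)
| Ueq_mulDr x y z : Ueq q t (x * (y + z)) (x * y + x * z)
| Ueq_constD c d : Ueq q t (Const (c + d)%R) (Const c + Const d)
| Ueq_constM c d : Ueq q t (Const (c * d)%R) (Const c * Const d)
| Ueq_constC c x : Ueq q t (Const c * x) (x * Const c)
| Ueq_starK x : Ueq q t (Star (Star x)) x
| Ueq_starD x y : Ueq q t (Star (x + y)) (Star x + Star y)
| Ueq_starM x y : Ueq q t (Star (x * y)) (Star y * Star x)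
| Ueq_starC c : Ueq q t (Star (Const c)) (Const (Num.conj c))
| Ueq_starX : Ueq q t (Star X) Y
| Ueq_starZ : Ueq q t (Star Z) Z
| Ueq_starB : Ueq q t (Star B) (- B)
| Ueq_XZ : Ueq q t (X * Z) ((q ^+ 2)%:C *: (Z * X))
| Ueq_YZ : Ueq q t (Y * Z) ((q ^- 2)%:C *: (Z * Y))
| Ueq_XY : Ueq q t (X * Y) (1 - (q * t)%R%:C *: Z - (q ^+ 2)%:C *: (Z * Z))
| Ueq_YX : Ueq q t (Y * X) (1 - (q^-1 * t)%R%:C *: Z - (q ^- 2)%:C *: (Z * Z))
| Ueq_BX : Ueq q t (B * X)
    ((q ^+ 2)%:C *: (X * B) + q%:C *: ((q + q^-1)%R%:C *: Z + Const t%:C))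
| Ueq_BY : Ueq q t (B * Y)
    ((q ^- 2)%:C *: (Y * B) + (q^-1)%:C *: ((q + q^-1)%R%:C *: Z + Const t%:C))
| Ueq_BZ : Ueq q t (B * Z) (Z * B - (X + Y)).

Local Close Scope term_scope.

Section UniversalAlgebra.
Context {R : realType} (q t : R).

Definition Ueqb (x y : term R) : bool := `[< Ueq q t x y >].

Fact Ueqb_equiv : equiv_class_of Ueqb.
Proof.
split=> [x|x y|y x z]; first exact/asboolP/Ueq_refl.
- by apply/asboolP/asboolP => /Ueq_sym.
- by move=> /asboolP xy /asboolP yz; apply/asboolP; exact: Ueq_trans xy yz.
Qed.

Canonical Ueqb_equiv_rel := EquivRelPack Ueqb_equiv.
Canonical Ueqb_enc := defaultEncModRel Ueqb.

Definition U : Type := {eq_quot Ueqb}.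
HB.instance Definition _ := Choice.on U.
HB.instance Definition _ := EqQuotient.on U.

Lemma U_eqP x y : \pi_U x = \pi_U y <-> Ueq q t x y.
Proof.
split=> [/eqP|xy]; first by rewrite piE => /asboolP.
by apply/eqP; rewrite piE; exact/asboolP.
Qed.

Lemma U_repr x : Ueq q t (repr (\pi_U x)) x.
Proof. by apply/U_eqP; rewrite reprK. Qed.

Definition U_const (c : R[i]) : U := \pi_U (Const c).
Definition U_add (x y : U) : U := \pi_U (repr x + repr y)%T.
Definition U_mul (x y : U) : U := \pi_U (repr x * repr y)%T.
Definition U_opp (x : U) : U := \pi_U (- repr x)%T.
Definition U_scale (c : R[i]) (x : U) : U := U_mul (U_const c) x.
Definition star (x : U) : U := \pi_U (Star (repr x)).

Lemma pi_Add x y : \pi_U (x + y)%T = U_add (\pi x) (\pi y).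
Proof. by apply/U_eqP/Ueq_sym/Ueq_add; exact: U_repr. Qed.

Lemma pi_Mul x y : \pi_U (x * y)%T = U_mul (\pi x) (\pi y).
Proof. by apply/U_eqP/Ueq_sym/Ueq_mul; exact: U_repr. Qed.

Lemma pi_Opp x : \pi_U (- x)%T = U_opp (\pi x).
Proof. by apply/U_eqP/Ueq_sym/Ueq_mul; [exact: Ueq_refl|exact: U_repr]. Qed.

Lemma pi_Star x : \pi_U (Star x) = star (\pi x).
Proof. by apply/U_eqP/Ueq_sym/Ueq_star/U_repr. Qed.

Fact U_addA : associative U_add.
Proof.
move=> x y z; rewrite -[x]reprK -[y]reprK -[z]reprK -!pi_Add.
exact/U_eqP/Ueq_addA.
Qed.

Fact U_addC : commutative U_add.
Proof.
by move=> x y; rewrite -[x]reprK -[y]reprK -!pi_Add; exact/U_eqP/Ueq_addC.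
Qed.

Fact U_add0 : left_id (U_const 0) U_add.
Proof. by move=> x; rewrite -[x]reprK -pi_Add; exact/U_eqP/Ueq_add0. Qed.

Fact U_addN : left_inverse (U_const 0) U_opp U_add.
Proof.
by move=> x; rewrite -[x]reprK -pi_Opp -pi_Add; exact/U_eqP/Ueq_addN.
Qed.

Fact U_mulA : associative U_mul.
Proof.
move=> x y z; rewrite -[x]reprK -[y]reprK -[z]reprK -!pi_Mul.
exact/U_eqP/Ueq_mulA.
Qed.

Fact U_mul1 : left_id (U_const 1) U_mul.
Proof. by move=> x; rewrite -[x]reprK -pi_Mul; exact/U_eqP/Ueq_mul1. Qed.

Fact U_constC c x : U_mul (U_const c) x = U_mul x (U_const c).
Proof. by rewrite -[x]reprK -!pi_Mul; exact/U_eqP/Ueq_constC. Qed.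

Fact U_mulr1 : right_id (U_const 1) U_mul.
Proof. by move=> x; rewrite -U_constC U_mul1. Qed.

Fact U_mulDl : left_distributive U_mul U_add.
Proof.
move=> x y z; rewrite -[x]reprK -[y]reprK -[z]reprK -!(pi_Mul, pi_Add).
exact/U_eqP/Ueq_mulDl.
Qed.

Fact U_mulDr : right_distributive U_mul U_add.
Proof.
move=> x y z; rewrite -[x]reprK -[y]reprK -[z]reprK -!(pi_Mul, pi_Add).
exact/U_eqP/Ueq_mulDr.
Qed.

HB.instance Definition _ :=
  GRing.isZmodule.Build U U_addA U_addC U_add0 U_addN.
(* A one-dimensional *-representation, showing that 1 != 0 in [U]. *)
Definition char_gen (r z b : R) (g : generator) : R[i] :=
  match g with
  | gX => 0 +i* r
  | gY => 0 -i* r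
  | gZ => z%:C
  | gB => 0 -i* b
  end.

Fixpoint char_eval (r z b : R) (x : term R) : R[i] :=
  match x with
  | Gen g => char_gen r z b g
  | Const c => c
  | Add x y => char_eval r z b x + char_eval r z b y
  | Mul x y => char_eval r z b x * char_eval r z b y
  | Star x => Num.conj (char_eval r z b x)
  end.

Lemma char_eval_Ueq (r z b : R) :
  z = q ^+ 2 * z -> z = q ^- 2 * z ->
  r ^+ 2 = 1 - q * t * z - q ^+ 2 * z ^+ 2 ->
  r ^+ 2 = 1 - q^-1 * t * z - q ^- 2 * z ^+ 2 ->
  b * r = q ^+ 2 * (b * r) + q * ((q + q^-1) * z + t) ->
  - (b * r) = - q ^- 2 * (b * r) + q^-1 * ((q + q^-1) * z + t) ->
  forall x y, Ueq q t x y -> char_eval r z b x = char_eval r z b y.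
Proof.
move=> hXZ hYZ hXY hYX hBX hBY x y; elim=> //=.
- by move=> ? ? ? _ -> _ ->.
- by move=> ? ? ? ? _ -> _ ->.
- by move=> ? ? ? ? _ -> _ ->.
- by move=> ? ? _ ->.
- by move=> ? ? ?; rewrite addrA.
- by move=> ? ?; rewrite addrC.
- by move=> ?; rewrite add0r.
- by move=> ?; rewrite mulN1r addNr.
- by move=> ? ? ?; rewrite mulrA.
- by move=> ?; rewrite mul1r.
- by move=> ? ? ?; rewrite mulrDl.
- by move=> ? ? ?; rewrite mulrDr.
- by move=> ? ?; rewrite mulrC.
- by move=> ?; rewrite conjCK.
- by move=> ? ?; rewrite rmorphD.
- by move=> ? ?; rewrite rmorphM mulrC.
all: apply/eqP; rewrite eq_complex /=; apply/andP; split; apply/eqP; simpc.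
all: try by (ring || lra).
- by rewrite mulrA -hXZ mulrC.
- by rewrite mulrA -hYZ mulrC.
Qed.

Fact U_one_neq0 : U_const 1 != U_const 0.
Proof.
suff [r [z [b [h1 h2 h3 h4 [h5 h6]]]]] : exists r z b : R,
    [/\ z = q ^+ 2 * z, z = q ^- 2 * z,
      r ^+ 2 = 1 - q * t * z - q ^+ 2 * z ^+ 2,
      r ^+ 2 = 1 - q^-1 * t * z - q ^- 2 * z ^+ 2 &
      b * r = q ^+ 2 * (b * r) + q * ((q + q^-1) * z + t) /\
      - (b * r) = - q ^- 2 * (b * r) + q^-1 * ((q + q^-1) * z + t)].
  apply/eqP => /U_eqP /(char_eval_Ueq h1 h2 h3 h4 h5 h6) /= /eqP.
  by rewrite oner_eq0.
have [q1|q1] := eqVneq (q ^+ 2) 1.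
  have qV : q^-1 = q.
    have q0 : q != 0 by apply: contra_eq_neq q1 => ->; rewrite expr0n eq_sym oner_eq0.
    by apply: (mulfI q0); rewrite divff // -expr2.
  exists (Num.sqrt (1 + t ^+ 2 / 4)), (- (q * t) / 2), 0.
  have p0 : 0 <= 1 + t ^+ 2 / 4 by rewrite addr_ge0 // mulr_ge0 ?sqr_ge0.
  rewrite sqr_sqrtr // q1 invr1 qV !mul1r !mul0r.
  have E : q * t * (q * t) = t ^+ 2 by rewrite mulrACA -expr2 q1 mul1r expr2.
  have F : q * ((q + q) * (- (q * t) / 2) + t) = 0.
    transitivity (q * t * (1 - q ^+ 2)); first by field.
    by rewrite q1 subrr mulr0.
  by split=> //; try split; rewrite ?F ?mulr0 ?oppr0 ?addr0 // -E; field.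
exists 1, 0, (q * t / (1 - q ^+ 2)); rewrite !mulr0 !expr0n !mulr0 !subr0 expr1n.
have d0 : 1 - q ^+ 2 != 0 by rewrite subr_eq0 eq_sym.
split=> //; split; first by field.
have [->|q0] := eqVneq q 0; first by rewrite !(invr0, mul0r, mulr0, oppr0, addr0).
by field; rewrite d0 q0.
Qed.


HB.instance Definition _ :=
  GRing.Zmodule_isNzRing.Build U U_mulA U_mul1 U_mulr1 U_mulDl U_mulDr U_one_neq0.

Fact U_scaleA c d x : U_scale c (U_scale d x) = U_scale (c * d) x.
Proof.
rewrite /U_scale U_mulA -pi_Mul; congr U_mul.
exact/U_eqP/Ueq_sym/Ueq_constM.
Qed.

Fact U_scaleDl x : {morph U_scale^~ x : c d / c + d}.
Proof.
move=> c d; rewrite /U_scale -[RHS]U_mulDl -pi_Add; congr U_mul.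
exact/U_eqP/Ueq_constD.
Qed.

HB.instance Definition _ := GRing.Zmodule_isLmodule.Build R[i] U
  U_scaleA U_mul1 (fun c => U_mulDr (U_const c)) U_scaleDl.

Fact U_scalerAl (c : R[i]) (x y : U) : c *: (x * y) = (c *: x) * y.
Proof. exact: U_mulA. Qed.

HB.instance Definition _ := GRing.Lmodule_isLalgebra.Build R[i] U U_scalerAl.

Fact U_scalerAr (c : R[i]) (x y : U) : c *: (x * y) = x * (c *: y).
Proof.
rewrite -[LHS]/(U_mul (U_const c) (U_mul x y)) U_mulA U_constC.
by rewrite -[LHS]U_mulA.
Qed.

HB.instance Definition _ := GRing.Lalgebra_isAlgebra.Build R[i] U U_scalerAr.

Definition Xt : U := \pi_U X.
Definition Yt : U := \pi_U Y.
Definition Zt : U := \pi_U Z.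
Definition Bt : U := \pi_U B.

Inductive Um : U -> Prop :=
| Um_X : Um Xt
| Um_Y : Um Yt
| Um_Z : Um Zt
| Um_1 : Um 1
| Um_add x y : Um x -> Um y -> Um (x + y)
| Um_scale (c : R[i]) x : Um x -> Um (c *: x)
| Um_mul x y : Um x -> Um y -> Um (x * y).

(* [qnum] is the q-number [x], [qbrace] is {x}. *)
Definition qnum (x : R) : R := (q `^ (- x) - q `^ x) / (q^-1 - q).
Definition qbrace (x : R) : R := q `^ x + q `^ (- x).

Definition At (c : R) : U :=
  ('i * (q^-1)%:C) *: Xt + (q `^ c - q `^ (- c))%:C *: Zt - ('i * q%:C) *: Yt.

End UniversalAlgebra.

Section Representations.
Context {R : realType} (q t : R).

Definition is_module (V : lmodType R[i]) (act : U q t -> V -> V) : Prop :=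
  [/\ forall v, linear (act^~ v), forall x, linear (act x),
      forall v, act 1 v = v & forall x y v, act (x * y) v = act x (act y v)].

Definition admissible (V : lmodType R[i]) (act : U q t -> V -> V) : Prop :=
  (forall v : V, exists (n : nat) (e : 'I_n -> V) (mu : 'I_n -> R[i]),
      (forall k, act ('i *: Bt q t) (e k) = mu k *: e k) /\ v = \sum_k e k) /\
  (forall mu : R[i], exists (n : nat) (e : 'I_n -> V), forall v : V,
      act ('i *: Bt q t) v = mu *: v ->
      exists c : 'I_n -> R[i], v = \sum_k c k *: e k).

Definition spectrum_in (a : R) (V : lmodType R[i]) (act : U q t -> V -> V) :
    Prop :=
  forall (mu : R[i]) (v : V), v != 0 -> act ('i *: Bt q t) v = mu *: v ->
  exists k : int, mu = (qnum q (a + k%:~R))%:C.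

Definition irreducible (V : lmodType R[i]) (act : U q t -> V -> V) : Prop :=
  (exists v : V, v != 0) /\
  forall W : submodClosed V,
    (forall x, {in W, forall v, act x v \in W}) ->
    (forall v, v \in W -> v = 0) \/ (forall v, v \in W).

Definition star_invariant (V : lmodType R[i]) (act : U q t -> V -> V)
    (f : V -> V -> R[i]) : Prop :=
  forall x u v, f u (act x v) = f (act (star x) u) v.

(* Hermitian forms follow the library: linear in the first variable, antilinear
   in the second. *)
Definition SL2_admissible_irreducible_star_rep (a : R) (V : lmodType R[i])
    (act : U q t -> V -> V) (ip : {dot V for Num.conj}) : Prop :=
  [/\ is_module act, star_invariant act ip, admissible act,
      spectrum_in a act & irreducible act].

Definition unitarily_equivalent (V V' : lmodType R[i])
    (act : U q t -> V -> V) (f : V -> V -> R[i])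
    (act' : U q t -> V' -> V') (f' : V' -> V' -> R[i]) : Prop :=
  exists2 phi : {linear V -> V'}, bijective phi &
    (forall x v, phi (act x v) = act' x (phi v)) /\
    (forall u v, f' (phi u) (phi v) = f u v).

(* This is a module structure when [W] is stable under [act]. *)
Definition quot_act (V : lmodType R[i]) (act : U q t -> V -> V)
    (W : submodClosed V) (x : U q t) (v : vquot W) : vquot W :=
  \pi_(vquot W) (act x (repr v)).

Definition sesquilinear (V : lmodType R[i]) (f : V -> V -> R[i]) : Prop :=
  (forall v, linear_for *%R (f^~ v)) /\
  (forall u, linear_for (Num.conj \; *%R) (f u)).

End Representations.

Section Lmodules.
Context {R : realType} (q t lambda b : R).
Local Notation U := (U q t).

(* [U \otimes_(C[B]) C_b] as the quotient of [U] by the left ideal generated by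
   [iB - qnum b]. *)
Definition ind_ideal_pred : pred U :=
  fun x => `[< exists u : U, x = u * ('i *: Bt q t - (qnum q b)%:C%:A) >].

Fact ind_ideal_closed : submod_closed ind_ideal_pred.
Proof.
split=> [|c _ _ /asboolP[u ->] /asboolP[v ->]]; apply/asboolP.
- by exists 0; rewrite mul0r.
- by exists (c *: u + v); rewrite mulrDl scalerAl.
Qed.

HB.instance Definition _ :=
  GRing.isSubmodClosed.Build R[i] U ind_ideal_pred ind_ideal_closed.

Definition ind_ideal : submodClosed U :=
  GRing.SubmodClosed.clone R[i] U ind_ideal_pred _.

Definition Ind : lmodType R[i] := vquot ind_ideal.
Definition Ind_act : U -> Ind -> Ind :=
  quot_act (V := U) (fun x y : U => x * y) (W := ind_ideal).

(* The class map restricts to a linear bijection from [Um] to [Ind]; this is the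
   image under it of the left ideal [Um (A_b - lambda)], which for [0 < q < 1]
   is stable under [U]. *)
Definition I_pred : pred Ind := fun x =>
  `[< exists2 m : U, Um m &
        x = \pi_(vquot ind_ideal) (m * (At q t b - lambda%:C%:A)) >].

Fact I_closed : submod_closed I_pred.
Proof.
split=> [|c _ _ /asboolP[m Umm ->] /asboolP[m' Umm' ->]]; apply/asboolP.
- exists (0 *: 1); first exact/Um_scale/Um_1.
  by rewrite scale0r mul0r; rewrite vquot0.
- exists (c *: m + m'); first exact/Um_add/Umm'/Um_scale.
  by rewrite mulrDl vquotD -scalerAl vquotZ.
Qed.

HB.instance Definition _ :=
  GRing.isSubmodClosed.Build R[i] Ind I_pred I_closed.

Definition I_sub : submodClosed Ind :=
  GRing.SubmodClosed.clone R[i] Ind I_pred _.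

Definition M : lmodType R[i] := vquot I_sub.
Definition M_act : U -> M -> M := quot_act Ind_act (W := I_sub).
Definition M_one : M := \pi_(vquot I_sub) (\pi_(vquot ind_ideal) (1 : U)).

(* For [0 < q < 1] there is exactly one such form. *)
Definition M_form : M -> M -> R[i] :=
  xget (fun _ _ => 0)
    [set f | [/\ sesquilinear f, star_invariant M_act f & f M_one M_one = 1]].

Lemma M_form_sesquilinear : sesquilinear M_form.
Proof.
rewrite /M_form; case: xgetP => [f _ [] //|_].
by split=> u c x y /=; rewrite mulr0 addr0.
Qed.

Definition N_pred : pred M := fun v => `[< forall u, M_form u v = 0 >].

Fact N_closed : submod_closed N_pred.
Proof.
have [_ lin] := M_form_sesquilinear.
split=> [|c x y /asboolP Nx /asboolP Ny]; apply/asboolP => u.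
- by have := lin u (-1) 0 0; rewrite scaler0 addr0 /= rmorphN1 mulN1r addNr.
- by rewrite lin /= Nx Ny mulr0 addr0.
Qed.

HB.instance Definition _ := GRing.isSubmodClosed.Build R[i] M N_pred N_closed.

Definition N_sub : submodClosed M :=
  GRing.SubmodClosed.clone R[i] M N_pred _.

Definition L : lmodType R[i] := vquot N_sub.
Definition L_act : U -> L -> L := quot_act M_act (W := N_sub).
Definition L_form (x y : L) : R[i] := M_form (repr x) (repr y).

End Lmodules.

Variant label (R : realType) : Type :=
| Lplus of R
| Lminus of R
| Dplus of int
| Eplus of int
| Dminus of int
| Eminus of int
| Triv
| Char.
Arguments Triv {R}.
Arguments Char {R}.

Section Labels.
Context {R : realType} (q a : R).

Definition label_valid (l : label R) : Prop :=
  match l with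
  | Lplus lambda => exists s : R,
      [/\ 0 <= s < 1, exists k : int, a + s = k%:~R
        & - (q `^ (1 - 2 * s) + q `^ (2 * s - 1)) < lambda < q^-1 + q]
  | Lminus lambda => exists s : R,
      [/\ 0 <= s < 1, exists k : int, a + s = 1 / 2 + k%:~R
        & - (q `^ (1 - 2 * s) + q `^ (2 * s - 1)) < lambda < 2]
  | Dplus n => (0 < n)%R
  | Eplus n => - (2 * a) < n%:~R
  | Dminus n => (0 < n)%R
  | Eminus n => 2 * a < n%:~R
  | Triv => True
  | Char => exists k : int, a = k%:~R / 2
  end.

Definition label_lambda (l : label R) : R :=
  match l with
  | Lplus lambda => lambda
  | Lminus lambda => lambda
  | Dplus n => qbrace q (n%:~R - 1)
  | Eplus n => - qbrace q (2 * a + n%:~R - 1)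
  | Dminus n => qbrace q (n%:~R - 1)
  | Eminus n => - qbrace q (- (2 * a) + n%:~R - 1)
  | Triv => q^-1 + q
  | Char => - (q^-1 + q)
  end.

Definition label_b (l : label R) : R :=
  match l with
  | Lplus _ => a
  | Lminus _ => a - 1
  | Dplus n => a + n%:~R
  | Eplus n => a + n%:~R
  | Dminus n => a - n%:~R
  | Eminus n => a - n%:~R
  | Triv => a
  | Char => - a
  end.

End Labels.

(* Main.v *)
(* The elements x = iX, y = -iY, z = Z and b = iB satisfy relations with real
   coefficients, the involution exchanges x and y and fixes z and b, and
     Om = q^-1 x - (q^-1 - q) z b + q y
   is central, self-adjoint, and acts as A_c on vectors of weight [c].  On a
   vector v of weight [c] with Om v = lam v,
     T^-_{c+2} T^+_c v = ({c-a+1} - lam) ({c+a+1} + lam) v,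
   and modulo other weights (T^+_c)^* = T^-_c is {c}/{c+2} T^-_{c+2} on weight
   [c+2], so |T^+_c v|^2 is a positive multiple of this factor times |v|^2.

   A module generated by such a v is spanned by the ladder vectors T^{+,(n)} v
   and T^{-,(n)} v, whose weights are distinct; hence an invariant form is
   determined by <v, v>.  On M_{lam,b} it exists as <y 1, x 1> = om(x^* y), for om
   the vacuum coefficient in an explicit tridiagonal module on the functions on
   the integers; om is Hermitian by the same uniqueness.  So L_{lam,b} is
   irreducible for all real lam and b, and every irreducible *-representation with
   a unit vector of weight [b] and Casimir value lam is L_{lam,b}.  What remains
   is to see which lam and b make the factors along the ladder nonnegative: either
   they are all positive, or the ladder stops at a lowest or a highest weight, where
   lam = {m} or -{m} and the sign of the neighbouring factor decides. *)
From HB Require Import structures.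
Require Import Defs.
From mathcomp Require Import all_boot all_order all_algebra.
From mathcomp Require Import complex ring lra zify.
From mathcomp Require Import all_classical all_reals all_analysis.

Set Implicit Arguments.
Unset Strict Implicit.
Unset Printing Implicit Defensive.

Import Order.TTheory GRing.Theory Num.Theory.
Local Open Scope ring_scope.
Local Open Scope complex_scope.
Local Open Scope quotient_scope.

(** * Linear combinations *)

(** The algebra is given by generators and relations only, so nothing says beforehand that [M] is
    nonzero or how large it is. No linear basis of [U] is constructed; the tridiagonal module takes
    its place. It is one concrete module with a vector of prescribed weight and Casimir value, and
    reading off a single coefficient there yields the form. It carries no inner product, so all real
    lam and b are covered at once. The number q^c enters the calculations as a free positive scalar
    K. The identities become rational in q, K and lam, with denominators built from q^-1 - q and
    from sums of positive terms, so that none vanishes. Finite-dimensional weight spaces serve to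
    find one Casimir eigenvector. Irreducibility makes it cyclic and centrality carries the
    eigenvalue along its ladder; this replaces Schur's lemma. An equivalence preserves lam, but b
    only modulo 2Z. The labels are told apart because a ladder cannot pass an extremal weight. *)

Section LinearReflection.
Variables (F : nzRingType) (V : lmodType F).

(** [ring] and [field] decide scalar identities only. A vector identity is therefore reflected into
    formal linear combinations and reduced to one scalar identity per atom. *)
Inductive lexp : Type :=
| LAtom of nat
| LZero
| LAdd of lexp & lexp
| LOpp of lexp
| LScale of F & lexp.

Fixpoint lval (env : seq V) (e : lexp) : V :=
  match e with
  | LAtom i => nth 0 env i
  | LZero => 0
  | LAdd a b => lval env a + lval env b
  | LOpp a => - lval env a
  | LScale c a => c *: lval env a
  end.

(** [Nat.eqb] lets [cbn] evaluate the comparison of concrete indices, leaving pure scalar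
    expressions. *)
Fixpoint lcoef (e : lexp) (i : nat) : F :=
  match e with
  | LAtom j => if Nat.eqb i j then 1 else 0
  | LZero => 0
  | LAdd a b => lcoef a i + lcoef b i
  | LOpp a => - lcoef a i
  | LScale c a => c * lcoef a i
  end.

Fixpoint same_coefs (e e' : lexp) (n : nat) : Prop :=
  match n with
  | 0%N => True
  | m.+1 => lcoef e m = lcoef e' m /\ same_coefs e e' m
  end.

Lemma lvalE env e : lval env e = \sum_(i < size env) lcoef e i *: nth 0 env i.
Proof.
elim: e => [j||a IHa b IHb|a IHa|c a IHa] /=; rewrite ?IHa ?IHb.
- have E i : Nat.eqb i j = (i == j) by elim: i j => [|i IH] [|j].
  have [ji|ij] := ltnP j (size env); last first.
    rewrite nth_default // big1 // => i _; rewrite E.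
    by rewrite ltn_eqF ?scale0r // (leq_trans (ltn_ord i)).
  rewrite (bigD1 (Ordinal ji)) //= E eqxx scale1r big1 ?addr0 // => i ne.
  by rewrite E (_ : (i : nat) == j = false) ?scale0r //; apply: contraNF ne.
- by rewrite big1 // => i _; rewrite scale0r.
- by rewrite -big_split; apply: eq_bigr => i _; rewrite scalerDl.
- by rewrite -sumrN; apply: eq_bigr => i _; rewrite scaleNr.
- by rewrite scaler_sumr; apply: eq_bigr => i _; rewrite scalerA.
Qed.

Lemma lval_eq env e e' : same_coefs e e' (size env) -> lval env e = lval env e'.
Proof.
rewrite !lvalE => h; apply: eq_bigr => -[i lti] _ /=; congr (_ *: _).
elim: (size env) lti h => // n IH; rewrite ltnS leq_eqVlt.
by move=> /predU1P[->|/IH h'] /= [] // _ /h'.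
Qed.

End LinearReflection.

(** The inner [match goal] runs [unify] while a term is being built; its failure selects the next
    branch. *)
Ltac atom_index a env :=
  lazymatch env with
  | ?b :: ?l =>
      match goal with
      | _ => let _ := match goal with _ => unify a b end in constr:(0%N)
      | _ => let n := atom_index a l in constr:(S n)
      end
  end.

Ltac add_atom a env :=
  lazymatch env with
  | nil => constr:([:: a])
  | ?b :: ?l =>
      match goal with
      | _ => let _ := match goal with _ => unify a b end in env
      | _ => let l' := add_atom a l in constr:(b :: l')
      end
  end.

Ltac atoms e env :=
  lazymatch e with
  | @GRing.add _ ?a ?b => let env' := atoms a env in atoms b env'
  | @GRing.opp _ ?a => atoms a env
  | @GRing.scale _ _ _ ?a => atoms a env
  | @GRing.zero _ => env
  | _ => add_atom e env
  end.

Ltac lreify F env e :=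
  lazymatch e with
  | @GRing.add _ ?a ?b =>
      let a' := lreify F env a in let b' := lreify F env b in
      constr:(LAdd a' b')
  | @GRing.opp _ ?a => let a' := lreify F env a in constr:(LOpp a')
  | @GRing.scale _ _ ?c ?a => let a' := lreify F env a in constr:(LScale c a')
  | @GRing.zero _ => constr:(@LZero F)
  | _ => let i := atom_index e env in constr:(@LAtom F i)
  end.

Ltac lin_coefs F :=
  lazymatch goal with
  | |- @eq ?V ?u ?v =>
      let env := atoms u (@nil V) in
      let env := atoms v env in
      let e := lreify F env u in
      let e' := lreify F env v in
      refine (@lval_eq F _ env e e' _);
      cbn [lcoef same_coefs Nat.eqb size]; repeat split
  end.

Ltac pos_by_sign :=
  repeat first [ assumption | exact: ltr01 | apply: addr_gt0 | apply: mulr_gt0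
               | apply: exprn_gt0 | rewrite invr_gt0 ].

(** Settles the side conditions of [field]: each denominator is known to be nonzero from the context
    or is built from positive quantities. *)
Ltac nonzero :=
  repeat (apply/andP; split);
  first [ assumption | apply: lt0r_neq0; pos_by_sign ].

(** * Weight vectors of the defining relations *)

Section Relations.
Variables (F : numFieldType) (q t : F) (V : lmodType F).
Hypotheses (q_gt0 : 0 < q) (q_lt1 : q < 1).
Variables (x y z b : {linear V -> V}).

Local Notation s := (q + q^-1).

Record real_rels : Prop := RealRels {
  rel_xz : forall v, x (z v) = q ^+ 2 *: z (x v);
  rel_yz : forall v, y (z v) = q ^- 2 *: z (y v);
  rel_xy : forall v, x (y v) = v - (q * t) *: z v - q ^+ 2 *: z (z v);
  rel_yx : forall v, y (x v) = v - (q^-1 * t) *: z v - q ^- 2 *: z (z v);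
  rel_bx : forall v, b (x v) = q ^+ 2 *: x (b v) - q *: (s *: z v + t *: v);
  rel_by : forall v, b (y v) = q ^- 2 *: y (b v) + q^-1 *: (s *: z v + t *: v);
  rel_bz : forall v, b (z v) = z (b v) - (x v - y v)
}.
Hypothesis rels : real_rels.
Let xz := rel_xz rels. Let yz := rel_yz rels.
Let xy := rel_xy rels. Let yx := rel_yx rels.
Let bx := rel_bx rels. Let by_ := rel_by rels. Let bz := rel_bz rels.

Definition casimir (v : V) : V := q^-1 *: x v - (q^-1 - q) *: z (b v) + q *: y v.

Let q0 : q != 0. Proof. exact: lt0r_neq0. Qed.
Let qq0 : q^-1 - q != 0.
Proof. by rewrite subr_eq0 gt_eqF // (lt_trans q_lt1) // invf_gt1. Qed.

(** The shape in which [field] asks for q^-1 - q to be nonzero. *)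
Let q21 : 1 + - q * q != 0.
Proof.
have : q * (q^-1 - q) != 0 by rewrite mulf_neq0.
by rewrite mulrBr divff // -mulNr.
Qed.

Let lin := (linearD x, linearD y, linearD z, linearD b, linearN x, linearN y,
  linearN z, linearN b, linearZZ x, linearZZ y, linearZZ z, linearZZ b).

Lemma casimir_x v : casimir (x v) = x (casimir v).
Proof.
rewrite /casimir bx !lin yx xy xz.
by lin_coefs F; field.
Qed.

Lemma casimir_y v : casimir (y v) = y (casimir v).
Proof.
rewrite /casimir by_ !lin yx xy yz.
by lin_coefs F; field.
Qed.

Lemma casimir_z v : casimir (z v) = z (casimir v).
Proof.
rewrite /casimir bz !lin yz xz.
by lin_coefs F; field.
Qed.

Lemma casimir_b v : casimir (b v) = b (casimir v).
Proof.
rewrite /casimir !lin bz bx by_ .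
by lin_coefs F; field.
Qed.

(** The operators T^+_c and T^-_c with q^c replaced by the scalar K; the signs of the y terms come
    from y = -iY. *)
Definition raise (K : F) (v : V) : V := K *: x v - s *: z v - K^-1 *: y v - t *: v.
Definition lower (K : F) (v : V) : V := - K^-1 *: x v - s *: z v + K *: y v - t *: v.

Definition weight (K : F) (v : V) : Prop := b v = ((K^-1 - K) / (q^-1 - q)) *: v.

Section Weight.
Variables (K lam : F) (v : V).
Hypotheses (K_gt0 : 0 < K) (wt : weight K v) (cas : casimir v = lam *: v).

Let K0 : K != 0. Proof. exact: lt0r_neq0. Qed.
(** On a weight vector z (b v) is a multiple of z v, so the Casimir equation is linear in x v and
    can be solved for it. *)
Lemma weight_x : x v = (q * lam) *: v - (q * (K - K^-1)) *: z v - q ^+ 2 *: y v.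
Proof.
move: cas; rewrite /casimir wt !lin => h.
rewrite -[LHS]scale1r -[1 in LHS](divff q0) -[LHS]scalerA.
rewrite (_ : q^-1 *: x v = lam *: v +
  ((q^-1 - q) *: z (((K^-1 - K) / (q^-1 - q)) *: v) - q *: y v)); last first.
  by rewrite -h !lin; lin_coefs F; ring.
rewrite lin.
by lin_coefs F; field; nonzero.
Qed.

(* On a weight vector x is eliminated through the Casimir relation; comparing
   the two expressions of y (x v) then eliminates y (y v). *)
Lemma weight_yy : y (y v) = (lam / q) *: y v - (q ^- 3 * (K - K^-1)) *: z (y v)
  - q ^- 2 *: (v - (q^-1 * t) *: z v - q ^- 2 *: z (z v)).
Proof.
rewrite -yx weight_x !lin yz.
by lin_coefs F; field; nonzero.
Qed.

Lemma weight_raise : weight (q ^+ 2 * K) (raise K v).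
Proof.
rewrite /weight /raise !lin bx by_ bz wt !lin weight_x.
by lin_coefs F; field; nonzero.
Qed.

Lemma weight_lower : weight (q ^- 2 * K) (lower K v).
Proof.
rewrite /weight /lower !lin bx by_ bz wt !lin weight_x.
by lin_coefs F; field; nonzero.
Qed.

Variable A : F.
Hypotheses (A_gt0 : 0 < A) (tA : t = A - A^-1).

(* [step lam (q^c)] is ({c - a + 1} - lam) ({c + a + 1} + lam) when A = q^a. *)
Definition step (K : F) : F :=
  (q * K / A + (q * K / A)^-1 - lam) * (q * K * A + (q * K * A)^-1 + lam).

(** Words of length two in x, y, z reduce on v to combinations of v, y v, z v, z (y v) and z (z v);
    all coefficients but that of v cancel. *)
Lemma lower_raise : lower (q ^+ 2 * K) (raise K v) = step K *: v.
Proof.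
rewrite /raise /lower !lin xy xz yz weight_x !lin ?xy ?xz ?yz weight_x !lin weight_yy.
by rewrite tA /step; lin_coefs F; field; nonzero.
Qed.

Lemma raise_lower : raise (q ^- 2 * K) (lower K v) = step (q ^- 2 * K) *: v.
Proof.
rewrite /raise /lower !lin xy xz yz weight_x !lin ?xy ?xz ?yz weight_x !lin weight_yy.
by rewrite tA /step; lin_coefs F; field; nonzero.
Qed.

(** The coefficients below solve for x v, y v, z v in terms of T^+ v, v and T^- v. For K = q^c the
    three denominators are, up to powers of q and K, {c}{c+1}, {c}{c-1} and {c+1}{c-1}. *)
Definition den_raise (K : F) := (K ^+ 2 + 1) * (q ^+ 2 * K ^+ 2 + 1).
Definition den_lower (K : F) := (K ^+ 2 + 1) * (K ^+ 2 + q ^+ 2).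
Definition den_stay (K : F) := (q ^+ 2 * K ^+ 2 + 1) * (K ^+ 2 + q ^+ 2).
Definition x_raise (K : F) := q ^+ 2 * K ^+ 3 / den_raise K.
Definition x_lower (K : F) := - (q ^+ 2 * K) / den_lower K.
Definition x_stay (K : F) :=
  q * K * ((q ^+ 2 + 1) * lam * K + q * t * (K ^+ 2 - 1)) / den_stay K.
Definition y_raise (K : F) := - K / den_raise K.
Definition y_lower (K : F) := K ^+ 3 / den_lower K.
Definition z_raise (K : F) := - q * K ^+ 2 / den_raise K.
Definition z_lower (K : F) := - q * K ^+ 2 / den_lower K.
Definition z_stay (K : F) :=
  q * K * (q * lam * (K ^+ 2 - 1) - (q ^+ 2 + 1) * t * K) / den_stay K.

Lemma x_decomp :
  x v = x_raise K *: raise K v + x_stay K *: v + x_lower K *: lower K v.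
Proof.
rewrite /raise /lower weight_x /x_raise /x_stay /x_lower /den_raise /den_lower /den_stay.
by lin_coefs F; field; nonzero.
Qed.

Lemma y_decomp :
  y v = y_raise K *: raise K v + x_stay K *: v + y_lower K *: lower K v.
Proof.
rewrite /raise /lower weight_x /y_raise /x_stay /y_lower /den_raise /den_lower /den_stay.
by lin_coefs F; field; nonzero.
Qed.

Lemma z_decomp :
  z v = z_raise K *: raise K v + z_stay K *: v + z_lower K *: lower K v.
Proof.
rewrite /raise /lower weight_x /z_raise /z_stay /z_lower /den_raise /den_lower /den_stay.
by lin_coefs F; field; nonzero.
Qed.

Definition shift_lower (L : F) := (L + L^-1) / (K + K^-1).

(** The adjoint of T^+_{c-2} is T^-_{c-2}, while the ladder applies T^-_c at weight c. The
    coefficients [beta] and [gamma] stay anonymous because they multiply vectors of other weights,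
    which disappear in norm computations. *)
Lemma lower_shift : exists beta gamma,
  lower (q ^- 2 * K) v =
  shift_lower (q ^- 2 * K) *: lower K v + beta *: v + gamma *: raise K v.
Proof.
set L := q ^- 2 * K.
exists (- L^-1 * x_stay K - s * z_stay K + L * x_stay K - t),
  (- L^-1 * x_raise K - s * z_raise K + L * y_raise K).
rewrite {1}/lower x_decomp y_decomp z_decomp /shift_lower.
rewrite /x_raise /x_stay /x_lower /y_raise /y_lower /z_raise /z_stay /z_lower.
rewrite /L /den_raise /den_lower /den_stay.
by lin_coefs F; field; nonzero.
Qed.

Lemma raise_shift : exists beta gamma,
  raise (q ^+ 2 * K) v =
  shift_lower (q ^+ 2 * K) *: raise K v + beta *: v + gamma *: lower K v.
Proof.
set L := q ^+ 2 * K.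
exists (L * x_stay K - s * z_stay K - L^-1 * x_stay K - t),
  (L * x_lower K - s * z_lower K - L^-1 * y_lower K).
rewrite {1}/raise x_decomp y_decomp z_decomp /shift_lower.
rewrite /x_raise /x_stay /x_lower /y_raise /y_lower /z_raise /z_stay /z_lower.
rewrite /L /den_raise /den_lower /den_stay.
by lin_coefs F; field; nonzero.
Qed.

End Weight.
End Relations.

(** * A tridiagonal module *)

Section Model.
Variables (F : numFieldType) (q t lam A K0 : F).
Hypotheses (q_gt0 : 0 < q) (q_lt1 : q < 1) (A_gt0 : 0 < A) (tA : t = A - A^-1).
Hypothesis K0_gt0 : 0 < K0.

(** No condition on supports: a tridiagonal operator reads three entries at a time, so it acts on
    all functions and identities are checked pointwise. *)
Definition seqZ : lmodType F := int -> F^o.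

Definition Kn (n : int) : F := K0 * q ^ (2 * n).

Let q0 : q != 0. Proof. exact: lt0r_neq0. Qed.

Lemma Kn_gt0 (n : int) : 0 < Kn n.
Proof. by rewrite mulr_gt0 // exprz_gt0. Qed.

Lemma KnS (n : int) : Kn (n + 1) = q ^+ 2 * Kn n.
Proof. by rewrite /Kn mulrDr expfzDr // mulr1 [in RHS]mulrCA -exprnP [q ^ _ * _]mulrC. Qed.

Lemma KnP (n : int) : Kn (n - 1) = q ^- 2 * Kn n.
Proof. by rewrite /Kn mulrBr expfzDr // mulr1 mulrA mulrC. Qed.

Lemma seqZE :
  (forall (f g : seqZ) n, (f + g) n = f n + g n) *
  (forall (f : seqZ) n, (- f) n = - f n) *
  (forall c (f : seqZ) n, (c *: f) n = c *: f n).
Proof. by []. Qed.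

(** A function f stands for the formal sum of the f(n) e_n, so each coefficient is evaluated at the
    weight of the source vector. *)
Definition tridiag (up st dn : F -> F) (f : seqZ) : seqZ := fun n =>
  up (Kn (n - 1)) *: f (n - 1) + st (Kn n) *: f n + dn (Kn (n + 1)) *: f (n + 1).

Fact tridiag_linear up st dn : linear (tridiag up st dn).
Proof.

move=> c f g; apply/funext => n.
rewrite !seqZE /tridiag !seqZE.
by lin_coefs F; ring.
Qed.
HB.instance Definition _ up st dn :=
  GRing.isLinear.Build F seqZ seqZ _ (tridiag up st dn) (tridiag_linear up st dn).

Let back (K : F) := step q lam A (q ^- 2 * K).

(* The coefficients are those of [x_decomp], [y_decomp] and [z_decomp] on a basis
   e_n with T^+ e_n = e_{n+1}; then [lower_raise] forces T^- e_{n+1} = step e_n. *)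
Definition model_x : {linear seqZ -> seqZ} :=
  tridiag (x_raise q) (x_stay q t lam) (fun K => x_lower q K * back K).
Definition model_y : {linear seqZ -> seqZ} :=
  tridiag (y_raise q) (x_stay q t lam) (fun K => y_lower q K * back K).
Definition model_z : {linear seqZ -> seqZ} :=
  tridiag (z_raise q) (z_stay q t lam) (fun K => z_lower q K * back K).
Definition model_b : {linear seqZ -> seqZ} :=
  tridiag (fun=> 0) (fun K => (K^-1 - K) / (q^-1 - q)) (fun=> 0).

Let q21 : 1 + - q * q != 0.
Proof.
have h : q^-1 - q != 0 by rewrite subr_eq0 gt_eqF // (lt_trans q_lt1) // invf_gt1.
have : q * (q^-1 - q) != 0 by rewrite mulf_neq0.
by rewrite mulrBr divff // -mulNr.
Qed.

(** [step] depends on A only through t = A - A^-1. In this form A is gone and the relations, which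
    contain t alone, can be compared. *)
Let back_E (K : F) : 0 < K -> back K =
  (K / q) ^+ 2 + (K / q) ^- 2 + t ^+ 2 + 2 - lam * t * (K / q - q / K) - lam ^+ 2.
Proof. by move=> K_gt0; rewrite /back /step tA; field; nonzero. Qed.

(* Off the diagonal the values of [back] may stay opaque. *)
Lemma model_rels : real_rels q t model_x model_y model_z model_b.
Proof.
have Kp := Kn_gt0.
split=> f; apply/funext => n; have := Kp n; set K := Kn n => K_gt0.
all: have S_gt0 : 0 < q ^+ 2 * K by rewrite mulr_gt0 // exprn_gt0.
all: rewrite ?seqZE /= /tridiag ?seqZE ?subrK ?addrK !(KnS, KnP) -/K.
all: rewrite /x_raise /x_lower /x_stay /y_raise /y_lower /z_raise /z_lower /z_stay.
all: rewrite /den_raise /den_lower /den_stay; lin_coefs F.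
all: try by field; nonzero.
all: by rewrite !mulr0 ?addr0 ?add0r ?mulr1 !back_E //; field; nonzero.
Qed.

Lemma model_casimir f : casimir q model_x model_y model_z model_b f = lam *: f.
Proof.
apply/funext => n; have := Kn_gt0 n; set K := Kn n => K_gt0.
rewrite /casimir ?seqZE /= /tridiag ?seqZE ?subrK ?addrK !(KnS, KnP) -/K.
rewrite /x_raise /x_lower /x_stay /y_raise /y_lower /z_raise /z_lower /z_stay.
by rewrite /den_raise /den_lower /den_stay; lin_coefs F; field; nonzero.
Qed.

Definition model_vac : seqZ := fun n => (n == 0)%:R.

Lemma model_bE f n : model_b f n = ((Kn n)^-1 - Kn n) / (q^-1 - q) * f n.
Proof. by rewrite /= /tridiag !scale0r add0r addr0. Qed.

Lemma Kn0 : Kn 0 = K0. Proof. by rewrite /Kn mulr0 mulr1. Qed.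

Lemma model_weight : weight q model_b K0 model_vac.
Proof.
apply/funext => n; rewrite model_bE /= /model_vac.
have [->|n0] := eqVneq n 0; first by rewrite Kn0.
by rewrite mulr0 seqZE (negPf n0) scaler0.
Qed.
End Model.

(** * The universal algebra and its modules *)

Section UniversalAlgebraFacts.
Context {R : realType} (q t : R).
Local Notation U := (U q t).
Local Notation C := R[i].
Local Notation qC := (q%:C : C).
Local Notation tC := (t%:C : C).

Lemma U_constE (c : C) : U_const q t c = c%:A :> U.
Proof. by rewrite -[LHS](U_mulr1). Qed.

Lemma pi_AddE (x y : term R) : \pi_U (Add x y) = \pi_U x + \pi_U y :> U.
Proof. exact: pi_Add. Qed.

Lemma pi_MulE (x y : term R) : \pi_U (Mul x y) = \pi_U x * \pi_U y :> U.
Proof. exact: pi_Mul. Qed.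

Lemma pi_ConstE (c : C) : \pi_U (Const c) = c%:A :> U.
Proof. exact: U_constE. Qed.

Lemma starD : {morph @star R q t : u v / u + v}.
Proof.
move=> u v; rewrite -[u]reprK -[v]reprK -pi_AddE -!pi_Star -pi_AddE.
exact/U_eqP/Ueq_starD.
Qed.

Lemma starM (u v : U) : star (u * v) = star v * star u.
Proof.
rewrite -[u]reprK -[v]reprK -pi_MulE -!pi_Star -pi_MulE.
exact/U_eqP/Ueq_starM.
Qed.

Lemma starK : involutive (@star R q t).
Proof. by move=> u; rewrite -[u]reprK -!pi_Star; exact/U_eqP/Ueq_starK. Qed.

Lemma star_const (c : C) : star (c%:A : U) = (Num.conj c)%:A.
Proof. by rewrite -!U_constE -pi_Star; exact/U_eqP/Ueq_starC. Qed.

Lemma starZ (c : C) (u : U) : star (c *: u) = Num.conj c *: star u.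
Proof. by rewrite -mulr_algl starM star_const mulr_algr. Qed.

Lemma star1 : star (1 : U) = 1.
Proof. by rewrite -[1]scale1r star_const rmorph1. Qed.

Lemma starX : star (Xt q t) = Yt q t.
Proof. by rewrite -pi_Star; exact/U_eqP/Ueq_starX. Qed.
Lemma starZt : star (Zt q t) = Zt q t.
Proof. by rewrite -pi_Star; exact/U_eqP/Ueq_starZ. Qed.
Lemma starB : star (Bt q t) = - Bt q t.
Proof.
rewrite -pi_Star; have -> : - Bt q t = \pi_U (Mul (Const (-1)) (Gen gB)) by rewrite pi_Opp.
exact/U_eqP/Ueq_starB.
Qed.

(* Locked so that rewriting with the module laws cannot see the scalars. *)
Fact real_form_key : unit. Proof. exact: tt. Qed.
Definition ux : U := locked_with real_form_key ('i *: Xt q t).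
Definition uy : U := locked_with real_form_key (- 'i *: Yt q t).
Definition uz : U := locked_with real_form_key (Zt q t).
Definition ub : U := locked_with real_form_key ('i *: Bt q t).

Lemma uxE : ux = 'i *: Xt q t. Proof. by rewrite /ux unlock. Qed.
Lemma uyE : uy = - 'i *: Yt q t. Proof. by rewrite /uy unlock. Qed.
Lemma uzE : uz = Zt q t. Proof. by rewrite /uz unlock. Qed.
Lemma ubE : ub = 'i *: Bt q t. Proof. by rewrite /ub unlock. Qed.

Lemma conj_real (r : R) : Num.conj (r%:C : C) = r%:C.
Proof. by apply/eqP; rewrite eq_complex /= ?oppr0 ?eqxx. Qed.

Lemma ii : 'i * 'i = -1 :> C.
Proof. by rewrite -expr2 sqrCi. Qed.

Lemma star_uy : star uy = ux.
Proof. by rewrite uyE uxE starZ -starX starK rmorphN /= conjCi opprK. Qed.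
Lemma star_ux : star ux = uy.
Proof. by rewrite -star_uy starK. Qed.
Lemma star_uz : star uz = uz. Proof. by rewrite uzE starZt. Qed.
Lemma star_ub : star ub = ub.
Proof. by rewrite ubE starZ conjCi starB scaleNr scalerN opprK. Qed.

Lemma XtE : Xt q t = - 'i *: ux.
Proof. by rewrite uxE scalerA mulNr ii opprK scale1r. Qed.
Lemma YtE : Yt q t = 'i *: uy.
Proof. by rewrite uyE scalerA mulrN ii opprK scale1r. Qed.
Lemma BtE : Bt q t = - 'i *: ub.
Proof. by rewrite ubE scalerA mulNr ii opprK scale1r. Qed.

Let piE := (pi_AddE, pi_MulE, pi_ConstE, mulr_algl).

Lemma U_XZ : Xt q t * Zt q t = qC ^+ 2 *: (Zt q t * Xt q t).
Proof. by have /U_eqP := Ueq_XZ q t; rewrite !piE rmorphXn. Qed.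
Lemma U_YZ : Yt q t * Zt q t = qC ^- 2 *: (Zt q t * Yt q t).
Proof. by have /U_eqP := Ueq_YZ q t; rewrite !piE fmorphV rmorphXn. Qed.
Lemma U_XY : Xt q t * Yt q t =
  1 - (qC * tC) *: Zt q t - qC ^+ 2 *: (Zt q t * Zt q t).
Proof.
have /U_eqP := Ueq_XY q t; rewrite !piE rmorphXn rmorphM.
by rewrite !scaleN1r scale1r.
Qed.
Lemma U_YX : Yt q t * Xt q t =
  1 - (qC^-1 * tC) *: Zt q t - qC ^- 2 *: (Zt q t * Zt q t).
Proof.
have /U_eqP := Ueq_YX q t; rewrite !piE !fmorphV rmorphXn rmorphM !fmorphV.
by rewrite !scaleN1r scale1r.
Qed.
Lemma U_BX : Bt q t * Xt q t = qC ^+ 2 *: (Xt q t * Bt q t)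
  + qC *: ((qC + qC^-1) *: Zt q t + tC%:A).
Proof.
have /U_eqP := Ueq_BX q t.
by rewrite !piE rmorphXn rmorphD fmorphV.
Qed.
Lemma U_BY : Bt q t * Yt q t = qC ^- 2 *: (Yt q t * Bt q t)
  + qC^-1 *: ((qC + qC^-1) *: Zt q t + tC%:A).
Proof.
have /U_eqP := Ueq_BY q t.
by rewrite !piE fmorphV rmorphXn rmorphD !fmorphV.
Qed.
Lemma U_BZ : Bt q t * Zt q t = Zt q t * Bt q t - (Xt q t + Yt q t).
Proof.
by have /U_eqP := Ueq_BZ q t; rewrite !piE scaleN1r.
Qed.

(** Terms may contain [Star] at any depth, so P is proved for u and [star u] together; up to scalars
    the four generators are permuted by the involution. *)
Lemma U_ind (P : U -> Prop) :
  (forall c : C, P c%:A) -> P ux -> P uy -> P uz -> P ub ->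
  (forall u v, P u -> P v -> P (u + v)) ->
  (forall u v, P u -> P v -> P (u * v)) -> forall u, P u.
Proof.
move=> Pc Px Py Pz Pb PD PM u; rewrite -[u]reprK.
have PZ c v : P v -> P (c *: v) by move=> ?; rewrite -mulr_algl; apply: PM.
suff [] : P (\pi_U (repr u)) /\ P (star (\pi_U (repr u))) by [].
elim: (repr u) => [[]|c|T [hT hT'] T' [hS hS']|T [hT hT'] T' [hS hS']|T [hT hT']].
- by change (P (Xt q t) /\ P (star (Xt q t))); rewrite starX XtE YtE; split; apply: PZ.
- change (P (Yt q t) /\ P (star (Yt q t))).
  by rewrite -[in star _]starX starK XtE YtE; split; apply: PZ.
- by change (P (Zt q t) /\ P (star (Zt q t))); rewrite starZt -uzE.
- change (P (Bt q t) /\ P (star (Bt q t))); rewrite starB -scaleN1r BtE.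
  by split; [exact/PZ|exact/PZ/PZ].
- by rewrite pi_ConstE star_const.
- by rewrite pi_AddE starD; split; apply: PD.
- by rewrite pi_MulE starM; split; apply: PM.
- by rewrite pi_Star starK.
Qed.

Lemma u_xz : ux * uz = qC ^+ 2 *: (uz * ux).
Proof. by rewrite uxE uzE -scalerAl U_XZ -scalerAr !scalerA mulrC. Qed.
Lemma u_yz : uy * uz = qC ^- 2 *: (uz * uy).
Proof. by rewrite uyE uzE -scalerAl U_YZ -scalerAr !scalerA mulrC. Qed.
Lemma u_xy : ux * uy = 1 - (qC * tC) *: uz - qC ^+ 2 *: (uz * uz).
Proof. by rewrite uxE uyE uzE -scalerAl -scalerAr scalerA mulrN ii opprK scale1r U_XY. Qed.
Lemma u_yx : uy * ux = 1 - (qC^-1 * tC) *: uz - qC ^- 2 *: (uz * uz).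
Proof. by rewrite uxE uyE uzE -scalerAl -scalerAr scalerA mulNr ii opprK scale1r U_YX. Qed.
Lemma u_bx : ub * ux = qC ^+ 2 *: (ux * ub) - qC *: ((qC + qC^-1) *: uz + tC%:A).
Proof.
rewrite ubE uxE uzE -scalerAl -scalerAr scalerA ii U_BX scaleN1r opprD.
by rewrite -scalerAl -scalerAr !scalerA -mulrA ii mulrN1 scaleNr.
Qed.
Lemma u_by : ub * uy = qC ^- 2 *: (uy * ub) + qC^-1 *: ((qC + qC^-1) *: uz + tC%:A).
Proof.
rewrite ubE uyE uzE -scalerAl -scalerAr scalerA mulrN ii opprK scale1r U_BY.
by rewrite -scalerAl -scalerAr !scalerA -mulrA mulNr ii opprK mulr1.
Qed.
Lemma u_bz : ub * uz = uz * ub - (ux - uy).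
Proof.
rewrite ubE uxE uyE uzE -scalerAl U_BZ scalerBr -scalerAr; congr (_ - _).
by rewrite scalerDr scaleNr opprK.
Qed.

End UniversalAlgebraFacts.

(** * Modules over U, the Casimir element, and modules given by operators *)

Section Modules.
Context {R : realType} (q t : R).
Local Notation U := (U q t).
Local Notation C := R[i].
Local Notation qC := (q%:C : C).
Local Notation tC := (t%:C : C).
Local Notation ux := (ux q t).
Local Notation uy := (uy q t).
Local Notation uz := (uz q t).
Local Notation ub := (ub q t).

Definition uO : U := locked_with (real_form_key)
  (qC^-1 *: ux - (qC^-1 - qC) *: (uz * ub) + qC *: uy).

Lemma uOE : uO = qC^-1 *: ux - (qC^-1 - qC) *: (uz * ub) + qC *: uy.
Proof. by rewrite /uO unlock. Qed.

Section Act.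
Context {V : lmodType C} {act : U -> V -> V} (Vmod : is_module act).

Lemma actM u w v : act (u * w) v = act u (act w v).
Proof. by case: Vmod. Qed.
Lemma act1 v : act 1 v = v.
Proof. by case: Vmod. Qed.
Fact act_linear u : linear (act u).
Proof. by case: Vmod. Qed.
Fact actl_linear v : linear (act^~ v).
Proof. by case: Vmod. Qed.

Definition actr (u : U) : {linear V -> V} :=
  HB.pack (act u) (GRing.isLinear.Build C V V _ (act u) (act_linear u)).
Definition actl (v : V) : {linear U -> V} :=
  HB.pack (act^~ v) (GRing.isLinear.Build C U V _ (act^~ v) (actl_linear v)).

Lemma actZl c u v : act (c *: u) v = c *: act u v.
Proof. exact: (linearZZ (actl v)). Qed.
Lemma actDl u w v : act (u + w) v = act u v + act w v.
Proof. exact: (linearD (actl v)). Qed.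
Lemma actNl u v : act (- u) v = - act u v.
Proof. exact: (linearN (actl v)). Qed.
Lemma act0l v : act 0 v = 0.
Proof. exact: (linear0 (actl v)). Qed.
Lemma actZr c u v : act u (c *: v) = c *: act u v.
Proof. exact: (linearZZ (actr u)). Qed.
Lemma actDr u v w : act u (v + w) = act u v + act u w.
Proof. exact: (linearD (actr u)). Qed.
Lemma act0r u : act u 0 = 0.
Proof. exact: (linear0 (actr u)). Qed.
Lemma act_const c v : act (c%:A) v = c *: v.
Proof. by rewrite actZl act1. Qed.

Definition actE := (actZl, actDl, actNl, act1).

Lemma mod_rels : real_rels qC tC (actr ux) (actr uy) (actr uz) (actr ub).
Proof.
split=> v /=; rewrite -!actM.
- by rewrite u_xz actE.
- by rewrite u_yz actE.
- by rewrite u_xy !actE.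
- by rewrite u_yx !actE.
- by rewrite u_bx !actE.
- by rewrite u_by !actE.
- by rewrite u_bz !actE.
Qed.

Lemma act_uO v :
  act uO v = casimir qC (actr ux) (actr uy) (actr uz) (actr ub) v.
Proof. by rewrite uOE !actE actM. Qed.

End Act.

Fact mul_module : is_module (fun u v : U => u * v).
Proof.
split=> [v c x y|x c v w|v|x y v] /=; first by rewrite mulrDl scalerAl.
- by rewrite mulrDr scalerAr.
- by rewrite mul1r.
- by rewrite mulrA.
Qed.

(** The involution swaps the coefficients of x and y; reordering b z into z b adds a multiple of x -
    y that swaps them back. *)
Lemma star_uO : star uO = uO.
Proof.
rewrite uOE !starD -scaleNr !starZ !starM star_ux star_uy star_uz star_ub.
rewrite u_bz !rmorphN !rmorphB !fmorphV /= !conj_real.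
by lin_coefs (R[i]); ring.
Qed.

Hypotheses (q_gt0 : 0 < q) (q_lt1 : q < 1).

Lemma qC_gt0 : 0 < qC. Proof. by rewrite ltcR. Qed.
Lemma qC_lt1 : qC < 1. Proof. by rewrite ltcR. Qed.

(** The operator identities for [casimir], read in the left regular module at the vector 1, become
    identities in the algebra. *)
Lemma uO_central (u : U) : uO * u = u * uO.
Proof.
have cas v := act_uO mul_module v; move: cas => /= cas.
have rels := mod_rels mul_module.
move: u; apply: U_ind => [c|||||u v hu hv|u v hu hv].
- by rewrite mulr_algr mulr_algl.
- by have := casimir_x qC_gt0 rels 1; rewrite -!cas /= !mulr1.
- by have := casimir_y qC_gt0 rels 1; rewrite -!cas /= !mulr1.
- by have := casimir_z qC_gt0 rels 1; rewrite -!cas /= !mulr1.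
- by have := casimir_b qC_gt0 rels 1; rewrite -!cas /= !mulr1.
- by rewrite mulrDr mulrDl hu hv.
- by rewrite mulrA hu -mulrA hv mulrA.
Qed.

(* As Star is a term constructor, terms are evaluated together with their formal
   adjoints: [ev true x] stands for the action of x^*. *)
Section OperatorRepresentation.
Variables (V : lmodType C) (x y z b : {linear V -> V}).
Hypothesis rels : real_rels qC tC x y z b.
Let q0 : qC != 0. Proof. exact/lt0r_neq0/qC_gt0. Qed.

Fixpoint ev (adj : bool) (T : term R) (v : V) : V :=
  match T with
  | Gen gX => if adj then 'i *: y v else - 'i *: x v
  | Gen gY => if adj then - 'i *: x v else 'i *: y v
  | Gen gZ => z v
  | Gen gB => if adj then 'i *: b v else - 'i *: b v
  | Const c => (if adj then Num.conj c else c) *: v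
  | Add T T' => ev adj T v + ev adj T' v
  | Mul T T' => if adj then ev adj T' (ev adj T v) else ev adj T (ev adj T' v)
  | Star T => ev (~~ adj) T v
  end.

Lemma ev_linear adj T : linear (ev adj T).
Proof.
elim: T adj => [g|c|T IH T' IH'|T IH T' IH'|T IH] adj a u v /=; last exact: IH.
- case: g; case: adj; rewrite linearP; lin_coefs (R[i]); ring.
- by case: adj; lin_coefs (R[i]); ring.
- by rewrite IH IH'; lin_coefs (R[i]); ring.
- by case: adj; rewrite ?(IH, IH') ?(IH, IH').
Qed.

Lemma evD adj T u v : ev adj T (u + v) = ev adj T u + ev adj T v.
Proof. by have := ev_linear adj T 1 u v; rewrite !scale1r. Qed.
Lemma ev0 adj T : ev adj T 0 = 0.
Proof. by apply: (addIr (ev adj T 0)); rewrite -evD addr0 add0r. Qed.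
Lemma evZ adj T c v : ev adj T (c *: v) = c *: ev adj T v.
Proof. by have := ev_linear adj T c v 0; rewrite ev0 !addr0. Qed.

(** [adj] is quantified inside because the congruence rule for [Star] flips it. For [adj = true] the
    formal adjoint of each relation has to hold: XZ and YZ are exchanged, BX and BY as well, and the
    others are self-adjoint. *)
Lemma ev_Ueq T T' : Ueq q t T T' -> forall adj, ev adj T =1 ev adj T'.
Proof.
have [rxz ryz rxy ryx rbx rby rbz] := rels.
have lin := (linearZZ x, linearZZ y, linearZZ z, linearZZ b).
have iiE : (forall v : V, 'i *: ('i *: v) = - v) *
    (forall v : V, - 'i *: ('i *: v) = v) *
    (forall v : V, 'i *: (- 'i *: v) = v) *
    (forall v : V, - 'i *: (- 'i *: v) = - v).
  by do !split; move=> v; rewrite scalerA ?(mulNr, mulrN) ii ?opprK ?scale1r ?scaleN1r.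
elim=> {T T'} /=.
- by [].
- by move=> T T' _ IH adj v; rewrite IH.
- by move=> T T' T'' _ IH _ IH' adj v; rewrite IH IH'.
- by move=> T T' S S' _ IH _ IH' adj v; rewrite IH IH'.
- by move=> T T' S S' _ IH _ IH' adj v; case: adj; rewrite !(IH, IH').
- by move=> T T' _ IH adj v; rewrite IH.
- by move=> T T' T'' adj v; rewrite addrA.
- by move=> T T' adj v; rewrite addrC.
- by move=> T adj v; case: adj; rewrite ?rmorph0 scale0r add0r.
- by move=> T adj v; case: adj; rewrite /= ?rmorphN ?rmorph1 ?rmorph0 scale0r ?evZ scaleN1r addNr.
- by move=> T T' T'' adj v; case: adj.
- by move=> T adj v; case: adj; rewrite ?rmorph1 scale1r.
- by move=> T T' T'' adj v; case: adj; rewrite ?evD.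
- by move=> T T' T'' adj v; case: adj; rewrite ?evD.
- by move=> c d adj v; case: adj; rewrite ?rmorphD scalerDl.
- by move=> c d adj v; case: adj; rewrite ?rmorphM scalerA 1?mulrC.
- by move=> c T adj v; case: adj; rewrite evZ.
- by move=> T adj v; rewrite negbK.
- by move=> T T' adj v.
- by move=> T T' adj v; case: adj.
- by move=> c adj v; case: adj; rewrite //= conjCK.
- by move=> adj v; case: adj.
- by [].
- by move=> adj v; case: adj; rewrite /= ?rmorphN ?rmorph1 ?lin; lin_coefs (R[i]); ring.
all: move=> adj v.
all: rewrite ?(fmorphV, rmorphXn, rmorphD, rmorphM, rmorphN, rmorph1) /=.
all: rewrite ?conj_real.
all: case: adj.
all: rewrite ?lin ?iiE ?rxz ?ryz ?rxy ?ryx ?rbx ?rby ?rbz.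
all: by lin_coefs (R[i]); field; rewrite ?q0.
Qed.
End OperatorRepresentation.

End Modules.

Section OperatorModule.
Context {R : realType} (q t : R).
Local Notation U := (U q t).
Local Notation C := R[i].
Local Notation qC := (q%:C : C).
Local Notation tC := (t%:C : C).
Hypotheses (q_gt0 : 0 < q).
Variables (V : lmodType C) (x y z b : {linear V -> V}).
Hypothesis rels : real_rels qC tC x y z b.

Definition op_act (u : U) (v : V) : V := ev x y z b false (repr u) v.

Lemma op_actE T v : op_act (\pi_(U) T) v = ev x y z b false T v.
Proof. exact: (ev_Ueq q_gt0 rels (U_repr q t T)). Qed.

Fact op_module : is_module op_act.
Proof.
split=> [v c u w|u|v|u w v].
- rewrite -[u]reprK -[w]reprK -mulr_algl -pi_ConstE -pi_MulE -pi_AddE.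
  by rewrite !op_actE.
- exact: ev_linear.
- by rewrite -[1]scale1r -pi_ConstE op_actE /= scale1r.
- by rewrite -[u]reprK -[w]reprK -pi_MulE !op_actE.
Qed.

Lemma op_act_ux v : op_act (ux q t) v = x v.
Proof. by rewrite uxE (actZl op_module) op_actE /= scalerA mulrN ii opprK scale1r. Qed.
Lemma op_act_uy v : op_act (uy q t) v = y v.
Proof. by rewrite uyE (actZl op_module) op_actE /= scalerA mulNr ii opprK scale1r. Qed.
Lemma op_act_uz v : op_act (uz q t) v = z v.
Proof. by rewrite uzE op_actE. Qed.
Lemma op_act_ub v : op_act (ub q t) v = b v.
Proof. by rewrite ubE (actZl op_module) op_actE /= scalerA mulrN ii opprK scale1r. Qed.

End OperatorModule.

(** * The elements T^+_c and T^-_c acting on weight vectors *)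

Section WeightVectors.
Context {R : realType} (q a t : R).
Hypotheses (q_gt0 : 0 < q) (q_lt1 : q < 1) (ta : t = q `^ a - q `^ (- a)).
Local Notation U := (U q t).
Local Notation C := R[i].
Local Notation qC := (q%:C : C).
Local Notation tC := (t%:C : C).
Local Notation ux := (ux q t).
Local Notation uy := (uy q t).
Local Notation uz := (uz q t).
Local Notation ub := (ub q t).
Local Notation uO := (uO q t).

Definition wK (c : R) : C := (q `^ c)%:C.

Lemma wK_gt0 c : 0 < wK c.
Proof. by rewrite ltcR powR_gt0. Qed.

Let q0 : q != 0. Proof. exact: lt0r_neq0. Qed.

Lemma wKS c : qC ^+ 2 * wK c = wK (c + 2).
Proof.
rewrite /wK powRD; last by rewrite q0 implybT.
by rewrite mulrC rmorphM powR_mulrn ?ltW // rmorphXn.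
Qed.

Lemma wKP c : qC ^- 2 * wK c = wK (c - 2).
Proof.
have /(canRL (mulKf _)) -> := wKS (c - 2); last by rewrite expf_neq0 // gt_eqF // qC_gt0.
by rewrite subrK.
Qed.

Lemma wKV c : (wK c)^-1 = wK (- c).
Proof. by rewrite /wK powRN fmorphV. Qed.

Lemma qnumE c : ((wK c)^-1 - wK c) / (qC^-1 - qC) = (qnum q c)%:C.
Proof. by rewrite /qnum wKV /wK rmorphM fmorphV !rmorphB fmorphV. Qed.

Lemma qbraceE c : wK c + (wK c)^-1 = (qbrace q c)%:C.
Proof. by rewrite /qbrace wKV /wK rmorphD. Qed.

Lemma tCE : tC = wK a - (wK a)^-1.
Proof. by rewrite ta wKV /wK rmorphB. Qed.

Definition norm_factor (lam c : R) : R :=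
  (qbrace q (c - a + 1) - lam) * (qbrace q (c + a + 1) + lam).

Lemma stepE lam c : step qC lam%:C (wK a) (wK c) = (norm_factor lam c)%:C.
Proof.
have D u v : wK u * wK v = wK (u + v).
  by rewrite /wK powRD ?rmorphM // q0 implybT.
have q1 : qC = wK 1 by rewrite /wK powRr1 // ltW.
have E1 : qC * wK c / wK a = wK (c - a + 1) by rewrite q1 wKV !D; congr wK; ring.
have E2 : qC * wK c * wK a = wK (c + a + 1) by rewrite q1 !D; congr wK; ring.
rewrite /step E1 E2 /norm_factor !qbraceE.
by move: (qbrace _ _) (qbrace _ _) => u v; rewrite rmorphM rmorphB rmorphD.
Qed.

(** [up c] is T^+_c and [dn c] is T^-_c, rewritten in the generators with real relations. *)
Definition up (c : R) : U :=
  wK c *: ux - (qC + qC^-1) *: uz - (wK c)^-1 *: uy - tC%:A.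
Definition dn (c : R) : U :=
  - (wK c)^-1 *: ux - (qC + qC^-1) *: uz + wK c *: uy - tC%:A.

Lemma star_up c : star (up c) = dn c.
Proof.
rewrite /up /dn -!scaleNr !starD !starZ star_ux star_uy star_uz star1.
rewrite !rmorphN rmorphD /= wKV fmorphV /= !conj_real.
by lin_coefs (R[i]); ring.
Qed.

Lemma star_dn c : star (dn c) = up c.
Proof. by rewrite -star_up starK. Qed.

Section Act.
Context {V : lmodType C} {act : U -> V -> V} (Vmod : is_module act).

Definition wt (c : R) (v : V) : Prop := act ub v = (qnum q c)%:C *: v.

Let ax := actr Vmod ux.
Let ay := actr Vmod uy.
Let az := actr Vmod uz.
Let ab := actr Vmod ub.
Let rels : real_rels qC tC ax ay az ab := mod_rels Vmod.

Lemma act_up c v : act (up c) v = raise qC tC ax ay az (wK c) v.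
Proof. by rewrite /up !(actE Vmod). Qed.
Lemma act_dn c v : act (dn c) v = lower qC tC ax ay az (wK c) v.
Proof. by rewrite /dn !(actE Vmod). Qed.

Lemma act_uO_comm u v : act uO (act u v) = act u (act uO v).
Proof. by rewrite -!(actM Vmod) uO_central. Qed.

Section Weight.
Variables (lam c : R) (v : V).
Hypotheses (vc : wt c v) (vO : act uO v = lam%:C *: v).

Let Kp := wK_gt0 c.
Let w1 : weight qC ab (wK c) v.
Proof. by rewrite /weight qnumE. Qed.
Let w2 : casimir qC ax ay az ab v = lam%:C *: v.
Proof. by rewrite -vO act_uO. Qed.
Let qp := qC_gt0 q_gt0.
Let q1 := qC_lt1 q_lt1.

Lemma wt_up : wt (c + 2) (act (up c) v).
Proof. rewrite /wt act_up -qnumE -wKS; refine (weight_raise qp q1 rels Kp w1 w2). Qed.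
Lemma wt_dn : wt (c - 2) (act (dn c) v).
Proof. rewrite /wt act_dn -qnumE -wKP; refine (weight_lower qp q1 rels Kp w1 w2). Qed.

Lemma dn_up : act (dn (c + 2)) (act (up c) v) = (norm_factor lam c)%:C *: v.
Proof.
rewrite act_dn act_up -wKS -stepE; refine (lower_raise qp q1 rels Kp w1 w2 (wK_gt0 a) tCE).
Qed.
Lemma up_dn : act (up (c - 2)) (act (dn c) v) = (norm_factor lam (c - 2))%:C *: v.
Proof.
rewrite act_dn act_up -stepE -wKP; refine (raise_lower qp q1 rels Kp w1 w2 (wK_gt0 a) tCE).
Qed.

(** This keeps the span of a ladder stable under x, y and z; only the existence of the coefficients
    matters there. *)
Lemma act_decomp u : u \in [:: ux; uy; uz] ->
  exists c1 c2 c3, act u v = c1 *: act (up c) v + c2 *: v + c3 *: act (dn c) v.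
Proof.
rewrite act_up act_dn !inE => /or3P[]/eqP ->; do 3 eexists.
- refine (x_decomp (x:=ax) (y:=ay) (z:=az) tC qp q1 Kp w1 w2).
- refine (y_decomp (x:=ax) (y:=ay) (z:=az) tC qp q1 Kp w1 w2).
- refine (z_decomp (x:=ax) (y:=ay) (z:=az) tC qp q1 Kp w1 w2).
Qed.

Lemma dn_shift : exists beta gamma, act (dn (c - 2)) v =
  (qbrace q (c - 2) / qbrace q c)%:C *: act (dn c) v + beta *: v + gamma *: act (up c) v.
Proof.
have [beta [gamma E]] := lower_shift tC qp q1 Kp w1 w2.
exists beta, gamma; rewrite act_up !act_dn -wKP E wKP.
by rewrite /shift_lower !qbraceE rmorphM fmorphV.
Qed.

Lemma up_shift : exists beta gamma, act (up (c + 2)) v =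
  (qbrace q (c + 2) / qbrace q c)%:C *: act (up c) v + beta *: v + gamma *: act (dn c) v.
Proof.
have [beta [gamma E]] := raise_shift tC qp q1 Kp w1 w2.
exists beta, gamma; rewrite act_dn !act_up -wKS E wKS.
by rewrite /shift_lower !qbraceE rmorphM fmorphV.
Qed.

End Weight.
End Act.
End WeightVectors.

(** * Ladders of weight vectors *)

Section QNumbers.
Context {R : realType} (q : R).
Hypotheses (q_gt0 : 0 < q) (q_lt1 : q < 1).

Lemma powR_decr (x y : R) : (q `^ x < q `^ y) = (y < x).
Proof.
rewrite /powR (gt_eqF q_gt0) ltr_expR ltr_nM2r //.
by rewrite ln_lt0 // q_gt0.
Qed.

Lemma qnum_inj : injective (qnum q).
Proof.
have d0 : 0 < q^-1 - q by rewrite subr_gt0 (lt_trans q_lt1) // invf_gt1.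
suff lt x y : x < y -> qnum q x < qnum q y.
  move=> x y; case: (ltgtP x y) => // /lt; first by move=> /lt_eqF/eqP.
  by move=> /gt_eqF/eqP.
by move=> xy; rewrite /qnum ltr_pM2r ?invr_gt0 // ltrB // powR_decr ?ltrN2.
Qed.

(** For 0 <= x < y both factors on the right are positive, which makes {x} strictly increasing in
    |x|. *)
Lemma qbrace_subE (x y : R) :
  qbrace q y - qbrace q x = (1 - q `^ (x + y)) * (q `^ (- y) - q `^ (- x)).
Proof.
have q0 : q != 0 by rewrite gt_eqF.
have D u v : q `^ u * q `^ v = q `^ (u + v) by rewrite powRD // q0 implybT.
rewrite /qbrace mulrBl mul1r mulrBr !D addrK [x + y]addrC addrK.
by ring.
Qed.

Lemma qbraceN (x : R) : qbrace q (- x) = qbrace q x.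
Proof. by rewrite /qbrace opprK addrC. Qed.

Lemma qbrace_norm (x : R) : qbrace q `|x| = qbrace q x.
Proof. by case: ger0P => // _; rewrite qbraceN. Qed.

Lemma qbrace_lt (x y : R) : (qbrace q x < qbrace q y) = (`|x| < `|y|).
Proof.
rewrite -(qbrace_norm x) -(qbrace_norm y).
have lt u v : 0 <= u -> u < v -> qbrace q u < qbrace q v.
  move=> u0 uv; rewrite -subr_gt0 qbrace_subE mulr_gt0 // subr_gt0.
    by rewrite -[1](powRr0 q) powR_decr (le_lt_trans _ (ltr_wpDl _ uv)).
  by rewrite powR_decr ltrN2.
have [h|h|->] := ltgtP `|x| `|y|; last by rewrite !ltxx.
  exact: lt.
by apply/negbTE; rewrite -leNgt ltW // lt.
Qed.

Lemma qbrace_le (x y : R) : (qbrace q x <= qbrace q y) = (`|x| <= `|y|).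
Proof. by rewrite !leNgt qbrace_lt. Qed.

Lemma qbrace_gt0 (x : R) : 0 < qbrace q x.
Proof. by rewrite addr_gt0 ?powR_gt0. Qed.

Lemma qbrace1 : qbrace q 1 = q^-1 + q.
Proof. by rewrite /qbrace powR_inv1 ?ltW // powRr1 ?ltW // addrC. Qed.

End QNumbers.

Section Ladder.
Context {R : realType} (q a t lam b : R).
Hypotheses (q_gt0 : 0 < q) (q_lt1 : q < 1) (ta : t = q `^ a - q `^ (- a)).
Local Notation U := (U q t).
Local Notation C := R[i].
Local Notation ux := (ux q t).
Local Notation uy := (uy q t).
Local Notation uz := (uz q t).
Local Notation ub := (ub q t).
Local Notation uO := (uO q t).
Local Notation up := (up q t).
Local Notation dn := (dn q t).

Fixpoint raise_pow (k : nat) : U :=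
  if k is m.+1 then up (b + 2 * m%:R) * raise_pow m else 1.
Fixpoint lower_pow (k : nat) : U :=
  if k is m.+1 then dn (b - 2 * m%:R) * lower_pow m else 1.

Definition ladder (n : int) : U :=
  match n with Posz k => raise_pow k | Negz k => lower_pow k.+1 end.

Definition weight_at (n : int) : R := b + 2 * n%:~R.

Lemma weight_atS n : weight_at (n + 1) = weight_at n + 2.
Proof. by rewrite /weight_at intrD; ring. Qed.
Lemma weight_atP n : weight_at (n - 1) = weight_at n - 2.
Proof. by rewrite /weight_at intrB; ring. Qed.
Lemma weight_at0 : weight_at 0 = b.
Proof. by rewrite /weight_at mulr0 addr0. Qed.
Lemma weight_at_inj : injective weight_at.
Proof. by move=> m n /addrI /(mulfI _) => /(_ _)/intr_inj; apply; rewrite pnatr_eq0. Qed.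

Lemma ladderS (k : nat) : ladder (Posz k + 1) = up (weight_at k) * ladder (Posz k).
Proof. by rewrite -PoszD addn1 /=. Qed.

Lemma ladderP (k : nat) : ladder (- Posz k - 1) = dn (weight_at (- Posz k)) * ladder (- Posz k).
Proof.
rewrite -opprD -PoszD addn1 -NegzE /= /weight_at; case: k => [|k] /=.
  by rewrite oppr0 !mulr0 subr0 addr0.
by rewrite -NegzE /= NegzE mulrNz mulrN.
Qed.

(** Negative integers are presented as one step down from -k, the form in which [ladderP]
    applies. *)
Variant sign_spec : int -> Prop :=
| SignPos (k : nat) : sign_spec (Posz k)
| SignNeg (k : nat) : sign_spec (- Posz k - 1).

Lemma signP n : sign_spec n.
Proof.
case: n => k; first by constructor.
by rewrite NegzE -addn1 PoszD opprD; constructor.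
Qed.

Section Act.
Context {V : lmodType C} {act : U -> V -> V} (Vmod : is_module act) (v0 : V).
Hypotheses (v0_wt : wt (act := act) b v0) (v0_cas : act uO v0 = lam%:C *: v0).

Definition e (n : int) : V := act (ladder n) v0.

Lemma e0E : e 0 = v0. Proof. exact: act1 Vmod v0. Qed.

Lemma e_cas n : act uO (e n) = lam%:C *: e n.
Proof. by rewrite (act_uO_comm q_gt0 Vmod) v0_cas (actZr Vmod). Qed.

Lemma e_wt n : wt (act := act) (weight_at n) (e n).
Proof.
case: (signP n) => k {n}; elim: k => [|k IH].
- by rewrite e0E weight_at0.
- rewrite -addn1 PoszD weight_atS /e ladderS (actM Vmod).
  exact: (wt_up q_gt0 q_lt1 Vmod IH (e_cas _)).
- rewrite weight_atP /e ladderP (actM Vmod).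
  by apply: (wt_dn q_gt0 q_lt1 Vmod _ (e_cas _)); rewrite oppr0 weight_at0 -/(e 0) e0E.
- rewrite weight_atP /e ladderP (actM Vmod).
  apply: (wt_dn q_gt0 q_lt1 Vmod _ (e_cas _)).
  by rewrite -addn1 PoszD opprD.
Qed.

(** At n >= 0 this is the construction of the ladder. Below 0 the vector arose by lowering, which
    the raising operator undoes up to the norm factor. *)
Lemma up_e n : exists c, act (up (weight_at n)) (e n) = c *: e (n + 1).
Proof.
case: (signP n) => k.
  by exists 1; rewrite scale1r /e ladderS (actM Vmod).
exists (norm_factor q a lam (weight_at (- Posz k) - 2))%:C.
rewrite subrK {1}/e ladderP (actM Vmod) weight_atP.
exact: (up_dn q_gt0 q_lt1 ta Vmod (e_wt _) (e_cas _)).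
Qed.

Lemma dn_e n : exists c, act (dn (weight_at n)) (e n) = c *: e (n - 1).
Proof.
case: n => [[|k]|k].
- exists 1; have E := ladderP 0; rewrite oppr0 in E.
  by rewrite scale1r /e E (actM Vmod).
- exists (norm_factor q a lam (weight_at k))%:C.
  rewrite -addn1 PoszD addrK {1}/e ladderS (actM Vmod) weight_atS.
  exact: (dn_up q_gt0 q_lt1 ta Vmod (e_wt _) (e_cas _)).
- by exists 1; rewrite scale1r NegzE /e ladderP (actM Vmod).
Qed.

Definition spanned (v : V) : Prop :=
  exists s : seq (int * C), v = \sum_(p <- s) p.2 *: e p.1.

Lemma spannedD v w : spanned v -> spanned w -> spanned (v + w).
Proof. by move=> [s ->] [s' ->]; exists (s ++ s'); rewrite big_cat. Qed.

Lemma spannedZ c v : spanned v -> spanned (c *: v).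
Proof.
move=> [s ->]; exists [seq (p.1, c * p.2) | p <- s].
by rewrite big_map scaler_sumr; apply: eq_bigr => p _; rewrite scalerA.
Qed.

Lemma spanned_e n : spanned (e n).
Proof. by exists [:: (n, 1)]; rewrite big_seq1 scale1r. Qed.

Lemma spanned0 : spanned 0.
Proof. by exists [::]; rewrite big_nil. Qed.

Lemma ladder_span u v : spanned v -> spanned (act u v).
Proof.
suff h n : spanned (act u (e n)).
  move=> [s ->]; elim: s => [|p s IH].
    by rewrite big_nil (act0r Vmod); exact: spanned0.
  by rewrite big_cons (actDr Vmod) (actZr Vmod); apply: spannedD => //; exact: spannedZ.
have stab (w : U) : (forall n, spanned (act w (e n))) -> forall v, spanned v -> spanned (act w v).
  move=> hw v' [s ->]; elim: s => [|p s IH].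
    by rewrite big_nil (act0r Vmod); exact: spanned0.
  by rewrite big_cons (actDr Vmod) (actZr Vmod); apply: spannedD => //; exact: spannedZ.
have gen w : w \in [:: ux; uy; uz] -> forall n, spanned (act w (e n)).
  move=> wg m.
  have [c1 [c2 [c3 ->]]] := act_decomp q_gt0 q_lt1 Vmod (e_wt m) (e_cas m) wg.
  have [d ->] := up_e m; have [d' ->] := dn_e m.
  by apply: spannedD; [apply: spannedD|]; do ?apply: spannedZ; exact: spanned_e.
move: u n; apply: U_ind => [c||||| u1 u2 h1 h2| u1 u2 h1 h2] n.
- by rewrite (act_const Vmod); apply/spannedZ/spanned_e.
- by apply: gen; rewrite inE eqxx.
- by apply: gen; rewrite !inE eqxx orbT.
- by apply: gen; rewrite !inE eqxx !orbT.
- by rewrite e_wt; apply/spannedZ/spanned_e.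
- by rewrite (actDl Vmod); apply: spannedD.
- by rewrite (actM Vmod); apply: stab.
Qed.

Lemma cyclic_spanned u : spanned (act u v0).
Proof. by apply: ladder_span; rewrite -e0E; exact: spanned_e. Qed.

(* A functional on U vanishing on the annihilator of v0 and of left weight b is
   determined by its value at 1, because U v0 is spanned by weight vectors of
   which only e 0 has weight b. *)
Lemma weight_functional_unique (om om' : U -> C) :
    scalar om -> scalar om' ->
    (forall u, act u v0 = 0 -> om u = 0) -> (forall u, act u v0 = 0 -> om' u = 0) ->
    (forall u, om (ub * u) = (qnum q b)%:C * om u) ->
    (forall u, om' (ub * u) = (qnum q b)%:C * om' u) ->
    om 1 = om' 1 -> om =1 om'.
Proof.
move=> lo lo' ko ko' wo wo' e1.
have val (f : U -> C) : scalar f -> (forall u, act u v0 = 0 -> f u = 0) ->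
    (forall u, f (ub * u) = (qnum q b)%:C * f u) ->
    forall u s, act u v0 = \sum_(p <- s) p.2 *: e p.1 ->
    f u = \sum_(p <- s | p.1 == 0) p.2 * f 1.
  move=> lf kf wf u s us.
  pose F : {scalar U} := HB.pack f (GRing.isLinear.Build C U C *%R f lf).
  have FE w : F w = f w by [].
  have fl (n : int) : f (ladder n) = (n == 0)%:R * f 1.
    have [->|n0] := eqVneq n 0; first by rewrite mul1r.
    have h : f (ub * ladder n - (qnum q (weight_at n))%:C *: ladder n) = 0.
      apply: kf; rewrite (actDl Vmod) (actNl Vmod) (actM Vmod) (actZl Vmod).
      by rewrite e_wt subrr.
    move: h; rewrite -FE linearB linearZ /= wf -mulrBl mul0r => /eqP.
    rewrite mulf_eq0 => /orP[|/eqP//]; rewrite -rmorphB /= => /eqP/complexI/eqP.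
    rewrite subr_eq0 => /eqP/(qnum_inj q_gt0 q_lt1); rewrite -{1}weight_at0.
    by move/weight_at_inj => n0'; rewrite -n0' eqxx in n0.
  have : f (u - \sum_(p <- s) p.2 *: ladder p.1) = 0.
    apply: kf; rewrite (actDl Vmod) (actNl Vmod) us; apply/eqP; rewrite subr_eq0.
    apply/eqP; elim: s {us} => [|p s IH]; first by rewrite !big_nil (act0l Vmod).
    by rewrite !big_cons (actDl Vmod) (actZl Vmod) IH.
  rewrite -FE linearB => /eqP; rewrite subr_eq0 => /eqP; rewrite FE => ->.
  rewrite linear_sum [RHS]big_mkcond; apply: eq_bigr => p _.
  by rewrite linearZ /= fl; case: eqP => _; rewrite ?mul1r // mul0r mulr0.
move=> u; have [s us] := cyclic_spanned u.
by rewrite (val _ lo ko wo _ _ us) (val _ lo' ko' wo' _ _ us) e1.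
Qed.

End Act.
End Ladder.

(** * The modules M and L *)

Section QuotientModule.
Context {R : realType} (q t : R).
Local Notation U := (U q t).
Context (V : lmodType R[i]) (act : U -> V -> V) (W : submodClosed V).
Hypotheses (Vmod : is_module act) (Wst : forall u, {in W, forall v, act u v \in W}).

Lemma quot_actE u v : quot_act act u (\pi_(vquot W) v) = \pi_(vquot W) (act u v).
Proof.
apply/vquotP.
have -> : act u (repr (\pi_(vquot W) v)) - act u v = act u (repr (\pi_(vquot W) v) - v).
  by rewrite -[RHS]/(actr Vmod u _) linearB.
by apply: Wst; apply/vquotP; rewrite reprK.
Qed.

Lemma quot_module : is_module (quot_act act (W := W)).
Proof.
split=> [v c x y|x c v w|v|x y v].
- rewrite -[v]reprK !quot_actE (actDl Vmod) (actZl Vmod) vquotD.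
  by congr (_ + _); exact: vquotZ.
- rewrite -[v]reprK -[w]reprK -[c *: _]vquotZ -vquotD !quot_actE.
  by rewrite (actDr Vmod) (actZr Vmod) vquotD; congr (_ + _); exact: vquotZ.
- by rewrite -[v]reprK quot_actE (act1 Vmod).
- by rewrite -[v]reprK (quot_actE (x * y)) (quot_actE y) (quot_actE x) (actM Vmod).
Qed.

End QuotientModule.

(** * The induced module and its quotient M *)

Section InducedModule.
Context {R : realType} (q a t lam b : R).
Hypotheses (q_gt0 : 0 < q) (q_lt1 : q < 1).
Local Notation U := (U q t).
Local Notation C := R[i].
Local Notation qC := (q%:C : C).
Local Notation ux := (ux q t).
Local Notation uy := (uy q t).
Local Notation uz := (uz q t).
Local Notation ub := (ub q t).
Local Notation uO := (uO q t).
Local Notation bC := ((qnum q b)%:C : C).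
Local Notation lamC := (lam%:C : C).
Local Notation J := (ind_ideal q t b).
Local Notation cl := (fun u : U => \pi_(vquot J) u).

Lemma in_ideal (u : U) : reflect (exists w : U, u = w * (ub - bC%:A)) (u \in J).
Proof. by rewrite ubE; apply: asboolP. Qed.

Lemma ideal_stable (u : U) : {in J, forall v, u * v \in J}.
Proof. by move=> v /in_ideal[w ->]; apply/in_ideal; exists (u * w); rewrite mulrA. Qed.

Let Umod := @mul_module R q t.

Lemma Ind_actE (u v : U) : Ind_act u (cl v) = cl (u * v).
Proof. exact: (quot_actE Umod ideal_stable). Qed.

Lemma Ind_module : is_module (@Ind_act R q t b).
Proof. exact: (quot_module Umod ideal_stable). Qed.

Lemma class_ub (u : U) : cl (u * ub) = cl (bC *: u).
Proof.
apply/vquotP/in_ideal; exists u.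
by rewrite mulrBr mulr_algr.
Qed.

Lemma Um_ux : Um ux. Proof. by rewrite uxE; apply/Um_scale/Um_X. Qed.
Lemma Um_uy : Um uy. Proof. by rewrite uyE; apply/Um_scale/Um_Y. Qed.
Lemma Um_uz : Um uz. Proof. by rewrite uzE; apply/Um_Z. Qed.

Lemma Um_const (c : C) : Um (c%:A : U).
Proof. exact/Um_scale/Um_1. Qed.

Lemma Um_opp (u : U) : Um u -> Um (- u).
Proof. by rewrite -scaleN1r; apply: Um_scale. Qed.

(** Normal ordering: b passes to the right of every word in X, Y, Z, with a correction that stays in
    [Um]. *)
Lemma ub_Um (m : U) : Um m -> exists m' m'' : U, [/\ Um m', Um m'' & ub * m = m' * ub + m''].
Proof.
have Zx := Um_scale _ Um_ux; have Zy := Um_scale _ Um_uy; have Zz := Um_scale _ Um_uz.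
have cZ c : Um (c *: ((qC + qC^-1) *: uz + t%:C%:A) : U).
  by apply/Um_scale/Um_add => //; exact: Um_const.
elim=> [||||x y _ [x1 [x2 [h1 h2 h]]] _ [y1 [y2 [k1 k2 k]]]|c x _ [x1 [x2 [h1 h2 h]]]
       |x y hx [x1 [x2 [h1 h2 h]]] hy [y1 [y2 [k1 k2 k]]]].
- exists (- 'i *: (qC ^+ 2 *: ux)), (- 'i *: - (qC *: ((qC + qC^-1) *: uz + t%:C%:A))).
  rewrite XtE -scalerAr u_bx -scalerAl -scalerAl -scalerDr.
  by split=> //; do ?apply: Um_scale => //; apply/Um_opp.
- exists ('i *: (qC ^- 2 *: uy)), ('i *: (qC^-1 *: ((qC + qC^-1) *: uz + t%:C%:A))).
  rewrite YtE -scalerAr u_by -scalerAl -scalerAl -scalerDr.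
  by split=> //; do ?apply: Um_scale => //.
- exists uz, (- (ux - uy)); rewrite -uzE u_bz.
  split=> //; first exact: Um_uz.
  by apply/Um_opp/Um_add; [exact: Um_ux | apply/Um_opp/Um_uy].
- exists 1, 0; rewrite mul1r mulr1 addr0; split=> //; first exact: Um_1.
  by rewrite -(scale0r 1); exact: Um_const.
- exists (x1 + y1), (x2 + y2); split; try exact: Um_add.
  by rewrite mulrDr h k mulrDl addrACA.
- exists (c *: x1), (c *: x2); split; try exact: Um_scale.
  by rewrite -scalerAr h scalerDr -scalerAl.
- exists (x1 * y1), (x1 * y2 + x2 * y).
  split; [exact: Um_mul | by apply: Um_add; exact: Um_mul |].
  by rewrite mulrA h mulrDl -mulrA k mulrDr !mulrA addrA.
Qed.

(** [I_sub] admits multipliers from [Um] only; this trades an arbitrary multiplier in [U] for one of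
    those. *)
Lemma Um_cover (u : U) : exists2 m : U, Um m & cl u = cl m.
Proof.
suff h : forall m : U, Um m -> exists2 m' : U, Um m' & cl (u * m) = cl m'.
  by have := h 1 (Um_1 _ _); rewrite mulr1.
move: u; apply: U_ind => [c|||||u v hu hv|u v hu hv] m mm.
- by exists (c *: m); [exact: Um_scale | rewrite mulr_algl].
- by exists (ux * m) => //; apply: Um_mul => //; exact: Um_ux.
- by exists (uy * m) => //; apply: Um_mul => //; exact: Um_uy.
- by exists (uz * m) => //; apply: Um_mul => //; exact: Um_uz.
- have [m1 [m2 [h1 h2 ->]]] := ub_Um mm; exists (bC *: m1 + m2).
    by apply: Um_add => //; exact: Um_scale.
  by rewrite !vquotD class_ub.
- have [m1 h1 e1] := hu _ mm; have [m2 h2 e2] := hv _ mm.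
  by exists (m1 + m2); [exact: Um_add | rewrite mulrDl !vquotD e1 e2].
- have [m1 h1 e1] := hv _ mm; have [m2 h2 e2] := hu _ h1.
  by exists m2 => //; rewrite -mulrA -Ind_actE e1 Ind_actE.
Qed.

Lemma uO_At : exists w : U, uO - At q t b = w * (ub - bC%:A).
Proof.
(* The Casimir element and A_b differ only in the z term, where b is replaced by [b], and q^b -
   q^(-b) = -(q^-1 - q) [b]. *)
exists (- (qC^-1 - qC) *: uz).
rewrite uOE /At XtE YtE -uzE mulrBr mulr_algr -scalerAl !scalerA.
have -> : (q `^ b - q `^ (- b))%:C = - (qC^-1 - qC) * bC.
  have d0 : qC^-1 - qC != 0.
    by rewrite subr_eq0 gt_eqF // (lt_trans (qC_lt1 q_lt1)) // invf_gt1 ?qC_gt0 // qC_lt1.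
  rewrite -qnumE mulrCA mulNr divff // mulrN1 opprB wKV /wK.
  by rewrite rmorphB.
have i1 : 'i * (q^-1)%:C * - 'i = qC^-1.
  by rewrite mulrAC mulrN ii opprK mul1r fmorphV.
have i2 : 'i * qC * 'i = - qC by rewrite mulrAC ii mulN1r.
by rewrite i1 i2; lin_coefs (R[i]); ring.
Qed.

Lemma class_At (m : U) : cl (m * (At q t b - lamC%:A)) = cl (m * (uO - lamC%:A)).
Proof.
have [w E] := uO_At; apply/vquotP/in_ideal; exists (- (m * w)).
by rewrite mulNr -mulrA -E -mulrBr -mulrN opprB; congr (m * _); rewrite opprB addrA subrK.
Qed.

Local Notation I := (I_sub q t lam b).

(** A_b is replaced by the central [uO] and [Um] by [U], so that I becomes the image of the left
    ideal U (uO - lam), whose stability under U is evident. *)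
Lemma in_I (u : U) : reflect (exists w, cl u = cl (w * (uO - lamC%:A))) (cl u \in I).
Proof.
have refl : reflect (exists2 m : U, Um m & cl u = cl (m * (At q t b - lamC%:A))) (cl u \in I).
  exact: asboolP.
apply: (iffP refl) => [[m mm ->]|[w E]]; first by exists m; rewrite class_At.
have [m mm wm] := Um_cover w; exists m => //.
rewrite class_At E -[uO - _]mulr1 !mulrA.
(* Classes can be multiplied on the left only, so the factor is moved there before the class of w is
   exchanged for that of m. *)
have cen v : v * (uO - lamC%:A) = (uO - lamC%:A) * v.
  by rewrite mulrBr mulrBl mulr_algl mulr_algr uO_central.
by rewrite !mulr1 !cen -!Ind_actE wm.
Qed.

Lemma I_stable (u : U) : {in I, forall v, Ind_act u v \in I}.
Proof.
move=> v; rewrite -[v]reprK => /in_I[w E]; rewrite Ind_actE; apply/in_I.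
by exists (u * w); rewrite -Ind_actE E Ind_actE mulrA.
Qed.

Lemma M_module : is_module (@M_act R q t lam b).
Proof. exact: (quot_module Ind_module I_stable). Qed.

Local Notation one := (M_one q t lam b).

Lemma M_act_one u : M_act u one = \pi_(vquot I) (cl u).
Proof.
rewrite /M_act (quot_actE Ind_module I_stable) Ind_actE.
by rewrite mulr1.
Qed.

Lemma M_cyclic (v : M q t lam b) : exists u, v = M_act u one.
Proof. by exists (repr (repr v)); rewrite M_act_one !reprK. Qed.

(** This presents M as the universal module on a vector with the two given eigenvalues; the symmetry
    of the state below also rests on it. *)
Lemma M_kernel u : M_act u one = 0 ->
  exists w1 w2 : U, u = w1 * (ub - bC%:A) + w2 * (uO - lamC%:A).
Proof.
rewrite M_act_one -(vquot0 I) => /vquotP; rewrite subr0 => /in_I[w2 /vquotP/in_ideal[w1 E]].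
by exists w1, w2; rewrite -E subrK.
Qed.

Lemma M_one_wt : wt (act := @M_act R q t lam b) b one.
Proof.
rewrite /wt -[in RHS](act1 M_module one) -(actZl M_module) !M_act_one.
by rewrite -[ub]mul1r class_ub.
Qed.

Lemma M_one_cas : M_act uO one = lamC *: one.
Proof.
rewrite -[in RHS](act1 M_module one) -(actZl M_module) !M_act_one.
have clB (u v : U) : cl u - cl v = cl (u - v) by rewrite -[u in LHS](subrK v) vquotD addrK.
by apply/vquotP; rewrite clB; apply/in_I; exists 1; rewrite mul1r.
Qed.

Lemma M_universal (V : lmodType C) (act : U -> V -> V) (v0 : V) :
  is_module act -> wt (act := act) b v0 -> act uO v0 = lamC *: v0 ->
  forall u, M_act u one = 0 -> act u v0 = 0.
Proof.
move=> Vmod v0b v0O u /M_kernel[w1 [w2 ->]].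
have k w c v : act w v = c *: v -> act (w - c%:A) v = 0.
  by move=> e; rewrite (actDl Vmod) (actNl Vmod) (act_const Vmod) e subrr.
by rewrite (actDl Vmod) !(actM Vmod) (k _ _ _ v0b) (k _ _ _ v0O) !(act0r Vmod) addr0.
Qed.

End InducedModule.

(** * Norms of raised and lowered vectors under an invariant form *)

Section InvariantForms.
Context {R : realType} (q a t : R).
Hypotheses (q_gt0 : 0 < q) (q_lt1 : q < 1) (ta : t = q `^ a - q `^ (- a)).
Local Notation U := (U q t).
Local Notation C := R[i].
Local Notation ub := (ub q t).
Local Notation uO := (uO q t).
Context {V : lmodType C} {act : U -> V -> V} (Vmod : is_module act).
Context {f : V -> V -> C} (fs : sesquilinear f) (fi : star_invariant act f).

Lemma sesqDl u v w : f (u + v) w = f u w + f v w.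
Proof. by have := fs.1 w 1 u v; rewrite scale1r mul1r. Qed.
Lemma sesq0l w : f 0 w = 0.
Proof. by apply: (addIr (f 0 w)); rewrite -sesqDl !add0r. Qed.
Lemma sesqZl c u w : f (c *: u) w = c * f u w.
Proof. by have := fs.1 w c u 0; rewrite addr0 sesq0l addr0. Qed.
Lemma sesqDr w u v : f w (u + v) = f w u + f w v.
Proof. by have := fs.2 w 1 u v; rewrite scale1r /= rmorph1 mul1r. Qed.
Lemma sesq0r w : f w 0 = 0.
Proof. by apply: (addIr (f w 0)); rewrite -sesqDr !add0r. Qed.
Lemma sesqZr c w u : f w (c *: u) = Num.conj c * f w u.
Proof. by have := fs.2 w c u 0; rewrite addr0 sesq0r addr0. Qed.

Lemma weight_orthogonal c d u w :
  wt (act := act) c u -> wt (act := act) d w -> c <> d -> f u w = 0.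
Proof.
move=> uc wd cd; have := fi ub u w; rewrite star_ub uc wd sesqZl sesqZr conj_real.
move/eqP; rewrite -subr_eq0 -mulrBl mulf_eq0 => /orP[|/eqP//].
by rewrite -rmorphB => /eqP/complexI/eqP; rewrite subr_eq0 => /eqP/(qnum_inj q_gt0 q_lt1) /esym.
Qed.

Section Norms.
Variables (lam c : R) (v : V).
Hypotheses (vc : wt (act := act) c v) (vO : act uO v = lam%:C *: v).

Lemma norm_up : f (act (up q t c) v) (act (up q t c) v) =
  (qbrace q c / qbrace q (c + 2) * norm_factor q a lam c)%:C * f v v.
Proof.
set w := act (up q t c) v.
have wc : wt (act := act) (c + 2) w := wt_up q_gt0 q_lt1 Vmod vc vO.
have wO : act uO w = lam%:C *: w by rewrite (act_uO_comm q_gt0 Vmod) vO (actZr Vmod).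
(* Moving [up c] across the form yields [dn c], whereas [dn_up] speaks of [dn (c + 2)]; the
   remaining terms have weights c + 2 and c + 4 and are orthogonal to v. *)
rewrite {1}/w -star_dn -fi.
have [be [ga]] := dn_shift q_gt0 q_lt1 Vmod wc wO; rewrite addrK => ->.
rewrite (dn_up q_gt0 q_lt1 ta Vmod vc vO) !sesqDr !sesqZr.
have uw : wt (act := act) (c + 2 + 2) (act (up q t (c + 2)) w) := wt_up q_gt0 q_lt1 Vmod wc wO.
rewrite (weight_orthogonal vc wc); last by lra.
rewrite (weight_orthogonal vc uw); last by lra.
by rewrite !mulr0 !addr0 !conj_real mulrA -rmorphM.
Qed.

Lemma norm_dn : f (act (dn q t c) v) (act (dn q t c) v) =
  (qbrace q c / qbrace q (c - 2) * norm_factor q a lam (c - 2))%:C * f v v.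
Proof.
set w := act (dn q t c) v.
have wc : wt (act := act) (c - 2) w := wt_dn q_gt0 q_lt1 Vmod vc vO.
have wO : act uO w = lam%:C *: w by rewrite (act_uO_comm q_gt0 Vmod) vO (actZr Vmod).
rewrite {1}/w -star_up -fi.
have [be [ga]] := up_shift q_gt0 q_lt1 Vmod wc wO; rewrite subrK => ->.
rewrite (up_dn q_gt0 q_lt1 ta Vmod vc vO) !sesqDr !sesqZr.
have uw : wt (act := act) (c - 2 - 2) (act (dn q t (c - 2)) w) := wt_dn q_gt0 q_lt1 Vmod wc wO.
rewrite (weight_orthogonal vc wc); last by lra.
rewrite (weight_orthogonal vc uw); last by lra.
by rewrite !mulr0 !addr0 !conj_real mulrA -rmorphM.
Qed.

End Norms.
End InvariantForms.

(** * Existence, uniqueness and symmetry of the invariant form on M *)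

Section VermaForm.
Context {R : realType} (q a t lam b : R).
Hypotheses (q_gt0 : 0 < q) (q_lt1 : q < 1) (ta : t = q `^ a - q `^ (- a)).
Local Notation U := (U q t).
Local Notation C := R[i].
Local Notation qC := (q%:C : C).
Local Notation tC := (t%:C : C).
Local Notation ux := (ux q t).
Local Notation uy := (uy q t).
Local Notation uz := (uz q t).
Local Notation ub := (ub q t).
Local Notation uO := (uO q t).
Local Notation bC := ((qnum q b)%:C : C).
Local Notation lamC := (lam%:C : C).
Local Notation one := (M_one q t lam b).
Local Notation Mact := (@M_act R q t lam b).

Let A : C := wK q a.
Let K0 : C := wK q b.
Let mx := model_x qC tC lamC A K0.
Let my := model_y qC tC lamC A K0.
Let mz := model_z qC tC lamC A K0.
Let mb := model_b qC K0.
Let qp := qC_gt0 q_gt0.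
Let q1 := qC_lt1 q_lt1.
Let A0 : 0 < A := wK_gt0 q_gt0 a.
Let K00 : 0 < K0 := wK_gt0 q_gt0 b.
Let rels : real_rels qC tC mx my mz mb :=
  @model_rels C qC tC lamC A K0 qp q1 A0 (tCE ta) K00.

Let mact := op_act (q := q) (t := t) mx my mz mb.
Let mmod : is_module mact := op_module q_gt0 rels.
Let vac : seqZ C := model_vac C.

Let vac_wt : wt (act := mact) b vac.
Proof.
by rewrite /wt /mact (op_act_ub q_gt0 rels) -qnumE; exact: model_weight.
Qed.

Let vac_cas : mact uO vac = lamC *: vac.
Proof.
rewrite (act_uO mmod) -(@model_casimir C qC tC lamC A K0 qp q1 K00) /casimir.
have -> : actr mmod ux vac = mx vac := op_act_ux q_gt0 rels vac.
have -> : actr mmod uy vac = my vac := op_act_uy q_gt0 rels vac.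
have -> : actr mmod ub vac = mb vac := op_act_ub q_gt0 rels vac.
by have -> : actr mmod uz (mb vac) = mz (mb vac) := op_act_uz q_gt0 rels _.
Qed.

Definition verma_state (u : U) : C := mact u vac 0.
Local Notation om := verma_state.

Lemma state_scalar : scalar om.
Proof.
by move=> c u v; rewrite /om (actDl mmod) (actZl mmod).
Qed.

Lemma state_kill u : Mact u one = 0 -> om u = 0.
Proof.
by move=> h; rewrite /om (M_universal q_gt0 q_lt1 mmod vac_wt vac_cas h).
Qed.

Lemma state1 : om 1 = 1.
Proof. by rewrite /om (act1 mmod). Qed.

Lemma state_ub_l u : om (ub * u) = bC * om u.
Proof.
rewrite /om (actM mmod) /mact (op_act_ub q_gt0 rels) /mb.
by rewrite [LHS](model_bE qC K0 _ 0) Kn0 qnumE.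
Qed.

Lemma state_ub_r u : om (u * ub) = bC * om u.
Proof. by rewrite /om (actM mmod) vac_wt (actZr mmod). Qed.

Lemma state_uO u : om (u * uO) = lamC * om u.
Proof. by rewrite /om (actM mmod) vac_cas (actZr mmod). Qed.

Let stateD u v : om (u + v) = om u + om v.
Proof. by rewrite /om (actDl mmod). Qed.
Let stateZ c v : om (c *: v) = c * om v.
Proof. by rewrite /om (actZl mmod). Qed.
Let stateN v : om (- v) = - om v.
Proof. by rewrite /om (actNl mmod). Qed.

Let Mmod := @M_module R q t lam b q_gt0 q_lt1.
Let one_wt := @M_one_wt R q t lam b q_gt0 q_lt1.
Let one_cas := @M_one_cas R q t lam b q_gt0 q_lt1.

Lemma state_star u : om (star u) = Num.conj (om u).
Proof.
rewrite -[LHS]conjCK; congr Num.conj; move: u.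
apply: (weight_functional_unique q_gt0 q_lt1 ta Mmod one_wt one_cas).
- by move=> c u v; rewrite starD starZ stateD stateZ rmorphD rmorphM /= conjCK.
- exact: state_scalar.
(* The star puts b - [b] and uO - lam on the left; the first is killed by the left weight of the
   state, the second by centrality. *)
- move=> u /(M_kernel q_gt0 q_lt1)[w1 [w2 ->]].
  have sN (c : C) (r : R) : c = r%:C -> star (- c%:A : U) = - r%:C%:A.
    by move=> ->; rewrite -scaleNr starZ star1 rmorphN /= conj_real scaleNr.
  rewrite starD !starM !starD star_ub star_uO !(sN _ _ erefl).
  rewrite !(mulrDl, mulNr, mulr_algl) (uO_central q_gt0).
  by rewrite !(stateD, stateN, stateZ) state_ub_l state_uO !subrr addr0 rmorph0.
- exact: state_kill.
- by move=> u; rewrite starM star_ub state_ub_r rmorphM /= conj_real.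
- exact: state_ub_l.
- by rewrite star1 state1 rmorph1.
Qed.

Lemma state_mul_kill w u : Mact u one = 0 -> om (w * u) = 0.
Proof. by move=> h; apply: state_kill; rewrite (actM Mmod) h (act0r Mmod). Qed.

Let rep (v : M q t lam b) : U := repr (repr v).
Let repK v : Mact (rep v) one = v.
Proof. by rewrite M_act_one // !reprK. Qed.

Definition verma_form (x y : M q t lam b) : C := om (star (rep y) * rep x).

Lemma state_congr w u u' : Mact u one = Mact u' one -> om (w * u) = om (w * u').
Proof.
move=> h; apply/eqP; rewrite -subr_eq0 -stateN -stateD -mulrN -mulrDr.
by rewrite state_mul_kill // (actDl Mmod) (actNl Mmod) h subrr.
Qed.

(** Independence of the representatives: [state_congr] treats the right factor, and conjugation by
    [state_star] brings the left factor there. *)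
Lemma verma_formE u w : verma_form (Mact u one) (Mact w one) = om (star w * u).
Proof.
rewrite /verma_form (state_congr _ (repK _)) -[LHS]conjCK -state_star starM starK.
by rewrite (state_congr _ (repK _)) -state_star starM starK.
Qed.

Lemma verma_form_spec :
  [/\ sesquilinear verma_form, star_invariant Mact verma_form & verma_form one one = 1].
Proof.
split.
- split=> v c x y.
  + rewrite -[v]repK -[x]repK -[y]repK -(actZl Mmod) -(actDl Mmod) !verma_formE.
    by rewrite mulrDr stateD -scalerAr stateZ.
  + rewrite -[v]repK -[x]repK -[y]repK -(actZl Mmod) -(actDl Mmod) !verma_formE.
    by rewrite starD mulrDl stateD starZ -scalerAl stateZ.
- move=> x u v; rewrite -[u]repK -[v]repK -!(actM Mmod) !verma_formE.
  by rewrite starM mulrA.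
- by rewrite -[one](act1 Mmod) verma_formE star1 mul1r state1.
Qed.

(** Stated for an arbitrary module: two representations with the same weight and Casimir value on a
    unit vector thus have the same state, which later gives their unitary equivalence. *)
Lemma form_unique (V : lmodType C) (act : U -> V -> V) (f : V -> V -> C) v0 :
  is_module act -> sesquilinear f -> star_invariant act f ->
  wt (act := act) b v0 -> act uO v0 = lamC *: v0 -> f v0 v0 = 1 ->
  forall u w, f (act u v0) (act w v0) = om (star w * u).
Proof.
move=> Vmod fs fi v0b v0O f1 u w; rewrite fi -(actM Vmod); move: (star w * u) => {u w}.
apply: (weight_functional_unique q_gt0 q_lt1 ta Mmod one_wt one_cas
          (om := fun u => f (act u v0) v0)) state_scalar _ state_kill _ state_ub_l _.
- by move=> c u v; rewrite (actDl Vmod) (actZl Vmod) (sesqDl fs) (sesqZl fs).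
- by move=> u /(M_universal q_gt0 q_lt1 Vmod v0b v0O) ->; rewrite (sesq0l fs).
- by move=> u; rewrite (actM Vmod) -star_ub -fi v0b (sesqZr fs) conj_real.
- by rewrite (act1 Vmod) f1 state1.
Qed.

Lemma M_form_spec : [/\ sesquilinear (@M_form R q t lam b),
  star_invariant Mact (@M_form R q t lam b) & M_form one one = 1].
Proof. by rewrite /M_form; case: xgetP => [f _ //|/(_ _ verma_form_spec)]. Qed.

Lemma M_form_state u w : M_form (Mact u one) (Mact w one) = om (star w * u).
Proof. by have [fs fi f1] := M_form_spec; exact: (form_unique Mmod fs fi). Qed.

Lemma M_form_herm (x y : M q t lam b) : M_form x y = Num.conj (M_form y x).
Proof.
by rewrite -[x]repK -[y]repK !M_form_state -state_star starM starK.
Qed.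

End VermaForm.

Section IrreducibleModules.
Context {R : realType} (q t : R).
Local Notation U := (U q t).
Local Notation C := R[i].
Local Notation uO := (uO q t).

Lemma submodule_of (V : lmodType C) (P : V -> Prop) :
  P 0 -> (forall c u v, P u -> P v -> P (c *: u + v)) ->
  exists W : submodClosed V, forall v, v \in W <-> P v.
Proof.
move=> P0 PD; pose pP : pred V := fun v => `[< P v >].
have cl : submod_closed pP.
  by split=> [|c u v /asboolP Pu /asboolP Pv]; apply/asboolP => //; exact: PD.
pose W : submodClosed V := HB.pack pP (GRing.isSubmodClosed.Build C V pP cl).
by exists W => v; split=> [/asboolP|Pv] //; apply/asboolP.
Qed.

Section Irreducible.
Context {V : lmodType C} {act : U -> V -> V}.
Hypotheses (Vmod : is_module act) (Virr : irreducible act).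

Lemma irreducible_ind (P : V -> Prop) :
  P 0 -> (forall c u v, P u -> P v -> P (c *: u + v)) ->
  (forall x v, P v -> P (act x v)) ->
  (exists2 v, P v & v != 0) -> forall v, P v.
Proof.
move=> P0 PD Pact [w Pw w0] v; have [W WP] := submodule_of P0 PD.
have [_ /(_ W)] := Virr; case=> [x u /WP Pu|h|h].
- exact/WP/Pact.
- by move: w0; rewrite (h w) ?eqxx //; exact/WP.
- exact/WP/h.
Qed.

Lemma irreducible_cyclic v0 : v0 != 0 -> forall v, exists u, act u v0 = v.
Proof.
move=> v00; apply: irreducible_ind.
- by exists 0; rewrite (act0l Vmod).
- by move=> c _ _ [u <-] [w <-]; exists (c *: u + w); rewrite (actDl Vmod) (actZl Vmod).
- by move=> x _ [u <-]; exists (x * u); rewrite (actM Vmod).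
- by exists v0 => //; exists 1; rewrite (act1 Vmod).
Qed.

End Irreducible.
End IrreducibleModules.

(** * The quotient L: weights, admissibility, irreducibility, positivity *)

Section SimpleQuotient.
Context {R : realType} (q a t lam b : R).
Hypotheses (q_gt0 : 0 < q) (q_lt1 : q < 1) (ta : t = q `^ a - q `^ (- a)).
Local Notation U := (U q t).
Local Notation C := R[i].
Local Notation ub := (ub q t).
Local Notation uO := (uO q t).
Local Notation bC := ((qnum q b)%:C : C).
Local Notation lamC := (lam%:C : C).
Local Notation N := (N_sub q t lam b).
Local Notation L := (L q t lam b).
Local Notation Lact := (@L_act R q t lam b).
Local Notation Mact := (@M_act R q t lam b).
Local Notation form := (@L_form R q t lam b).

Let Mmod := @M_module R q t lam b q_gt0 q_lt1.
Let Mfs := let: And3 h _ _ := M_form_spec lam b q_gt0 q_lt1 ta in h.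
Let Mfi := let: And3 _ h _ := M_form_spec lam b q_gt0 q_lt1 ta in h.

Definition L_one : L := \pi_(vquot N) (M_one q t lam b).
Local Notation one := L_one.

Lemma in_N (v : M q t lam b) : reflect (forall u, M_form u v = 0) (v \in N).
Proof. exact: asboolP. Qed.

Lemma N_stable (u : U) : {in N, forall v, Mact u v \in N}.
Proof. by move=> v /in_N Nv; apply/in_N => w; rewrite Mfi. Qed.

Lemma L_module : is_module Lact.
Proof. exact: (quot_module Mmod N_stable). Qed.
Let Lmod := L_module.

Lemma L_actE u v : Lact u (\pi_(vquot N) v) = \pi_(vquot N) (Mact u v).
Proof. exact: (quot_actE Mmod N_stable). Qed.

(** [N_pred] is the radical in the second argument; Hermitian symmetry shows that it is also the
    radical in the first. *)
Lemma L_formE u v : form (\pi_(vquot N) u) (\pi_(vquot N) v) = M_form u v.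
Proof.
have e w : exists2 n, n \in N & repr (\pi_(vquot N) w) = n + w.
  exists (repr (\pi_(vquot N) w) - w); last by rewrite subrK.
  by apply/vquotP; rewrite reprK.
have [m /in_N Nm em] := e u; have [n /in_N Nn en] := e v.
rewrite /L_form em en (sesqDl Mfs) !(sesqDr Mfs) !Nn add0r.
by rewrite (M_form_herm q_gt0 q_lt1 ta m) Nm rmorph0 !add0r.
Qed.

Lemma L_form_sesquilinear : sesquilinear form.
Proof.
split=> v c x y; rewrite -[v]reprK -[x]reprK -[y]reprK.
  rewrite (_ : c *: _ + _ = \pi_(vquot N) (c *: repr x + repr y)).
    by rewrite !L_formE (sesqDl Mfs) (sesqZl Mfs).
  by rewrite vquotD; congr (_ + _); rewrite [RHS]vquotZ.
rewrite (_ : c *: _ + _ = \pi_(vquot N) (c *: repr x + repr y)).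
  by rewrite !L_formE (sesqDr Mfs) (sesqZr Mfs).
by rewrite vquotD; congr (_ + _); rewrite [RHS]vquotZ.
Qed.
Let fs := L_form_sesquilinear.

Lemma L_form_invariant : star_invariant Lact form.
Proof.
by move=> x u v; rewrite -[u]reprK -[v]reprK !L_actE !L_formE Mfi.
Qed.
Let fi := L_form_invariant.

Lemma L_form_herm u v : form u v = Num.conj (form v u).
Proof. by rewrite -[u]reprK -[v]reprK !L_formE (M_form_herm q_gt0 q_lt1 ta). Qed.

Lemma L_form_one : form one one = 1.
Proof. by rewrite L_formE; have [] := M_form_spec lam b q_gt0 q_lt1 ta. Qed.

Lemma L_form_nondegenerate v : (forall u, form u v = 0) -> v = 0.
Proof.
rewrite -[v]reprK => h; rewrite -(vquot0 N); apply/vquotP; rewrite subr0.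
by apply/in_N => u; rewrite -L_formE.
Qed.

Lemma L_one_wt : wt (act := Lact) b one.
Proof.
rewrite /wt L_actE (@M_one_wt R q t lam b q_gt0 q_lt1); exact: vquotZ.
Qed.

Lemma L_one_cas : Lact uO one = lamC *: one.
Proof.
by rewrite L_actE (@M_one_cas R q t lam b q_gt0 q_lt1); exact: vquotZ.
Qed.

Lemma L_cyclic v : exists u, v = Lact u one.
Proof.
have [u e] := @M_cyclic R q t lam b q_gt0 q_lt1 (repr v).
by exists u; rewrite L_actE -e reprK.
Qed.

Lemma L_casimir v : Lact uO v = lamC *: v.
Proof.
have [u ->] := L_cyclic v.
by rewrite (act_uO_comm q_gt0 Lmod) L_one_cas (actZr Lmod).
Qed.

Definition L_vec (n : int) : L := e (act := Lact) b one n.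
Local Notation ev := L_vec.

Lemma L_vec_wt n : wt (act := Lact) (weight_at b n) (ev n).
Proof. exact: (e_wt q_gt0 q_lt1 Lmod L_one_wt L_one_cas). Qed.

Lemma L_vec0 : ev 0 = one.
Proof. exact: e0E. Qed.

Lemma L_vec_orth m n : m <> n -> form (ev m) (ev n) = 0.
Proof.
move=> mn; apply: (weight_orthogonal q_gt0 q_lt1 fs fi (L_vec_wt m) (L_vec_wt n)).
by move/weight_at_inj.
Qed.

(** The ladder may stop, so some [ev n] can be zero and coordinates are not unique. Repeated indices
    are merged to let orthogonality extract single terms. *)
Lemma L_span v : exists (s : seq int) (g : int -> C),
  uniq s /\ v = \sum_(n <- s) g n *: ev n.
Proof.
have [u ->] := L_cyclic v.
have [s ->] := cyclic_spanned q_gt0 q_lt1 ta Lmod L_one_wt L_one_cas u.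
exists (undup [seq p.1 | p <- s]), (fun n => \sum_(p <- s | p.1 == n) p.2).
split; first exact: undup_uniq.
under [RHS]eq_bigr do rewrite scaler_suml big_mkcond.
rewrite exchange_big /= big_seq [RHS]big_seq; apply: eq_bigr => p ps.
rewrite (bigD1_seq p.1) ?undup_uniq ?mem_undup ?map_f //=.
  by rewrite eqxx big1 ?addr0 // => n; rewrite eq_sym => /negPf ->.
Qed.

Lemma L_form_sum_r (s : seq int) (g : int -> C) m : uniq s ->
  form (ev m) (\sum_(n <- s) g n *: ev n) =
  (m \in s)%:R * (Num.conj (g m) * form (ev m) (ev m)).
Proof.
elim: s => [_|n s IH] /=; first by rewrite big_nil (sesq0r fs) mul0r.
move=> /andP[ns us]; rewrite big_cons (sesqDr fs) (sesqZr fs) (IH us) in_cons.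
have [->|mn] := eqVneq m n; first by rewrite (negPf ns) mul0r addr0 mul1r.
by rewrite (L_vec_orth (elimN eqP mn)) mulr0 add0r.
Qed.

Lemma L_vec_null n : form (ev n) (ev n) = 0 -> ev n = 0.
Proof.
move=> h; apply: L_form_nondegenerate => u; have [s [g [us ->]]] := L_span u.
by rewrite L_form_herm L_form_sum_r // h !mulr0 rmorph0.
Qed.

Lemma L_eigenvector (mu : C) v : Lact ('i *: Bt q t) v = mu *: v -> v != 0 ->
  exists n c, [/\ mu = (qnum q (weight_at b n))%:C, ev n != 0 & v = c *: ev n].
Proof.
rewrite -ubE => vmu v0; have [s [g [us vE]]] := L_span v.
(* Pairing v with [ev n] isolates the n-th term. Self-adjointness of b then forces equal eigenvalues
   unless the pairing is zero, and a null ladder vector is itself zero. *)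
have key n : n \in s -> mu <> (qnum q (weight_at b n))%:C -> g n *: ev n = 0.
  move=> ns mun; have := fi ub v (ev n).
  rewrite star_ub vmu L_vec_wt (sesqZl fs) (sesqZr fs) conj_real => /eqP.
  rewrite -subr_eq0 -mulrBl mulf_eq0 subr_eq0 => /orP[/eqP/esym//|/eqP].
  rewrite L_form_herm vE L_form_sum_r // ns mul1r rmorphM /= conjCK -L_form_herm => /eqP.
  by rewrite mulf_eq0 => /orP[/eqP->|/eqP/L_vec_null->]; rewrite ?scale0r ?scaler0.
have [[n [ns nz]]|none] := pselect (exists n, n \in s /\ g n *: ev n != 0); last first.
  case/eqP: v0; rewrite vE big_seq big1 // => n ns.
  by apply/eqP/negPn/negP => nz; apply: none; exists n.
have mun : mu = (qnum q (weight_at b n))%:C.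
  by apply: contrapT => /(key n ns)/eqP; rewrite (negPf nz).
exists n, (g n); split; first exact: mun.
  by apply: contraNneq nz => ->; rewrite scaler0.
rewrite vE (bigD1_seq n ns us) /= big_seq_cond big1 ?addr0 // => m /andP[ms mn].
apply: key => //; rewrite mun => /complexI/(qnum_inj q_gt0 q_lt1)/weight_at_inj/esym/eqP.
by rewrite (negPf mn).
Qed.

Lemma L_admissible : admissible Lact.
Proof.
split=> [v|mu].
  have [s [g [us vE]]] := L_span v.
  exists (size s), (fun k => g (nth 0 s k) *: ev (nth 0 s k)),
    (fun k => (qnum q (weight_at b (nth 0 s k)))%:C); split=> [k|].
    by rewrite -ubE (actZr Lmod) L_vec_wt !scalerA mulrC.
  by rewrite vE (big_nth 0) big_mkord.
have [[n mun]|none] := pselect (exists n, mu = (qnum q (weight_at b n))%:C).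
  exists 1%N, (fun=> ev n) => v vmu; have [->|v0] := eqVneq v 0.
    by exists (fun=> 0); rewrite big1 // => k _; rewrite scale0r.
  have [m [c [mum _ ->]]] := L_eigenvector vmu v0.
  exists (fun=> c); rewrite big_ord1; congr (_ *: ev _); move: mum; rewrite mun.
  by move=> /complexI/(qnum_inj q_gt0 q_lt1)/weight_at_inj.
exists 0%N, (fun=> 0) => v vmu; exists (fun=> 0); rewrite big_ord0.
apply/eqP/negPn/negP => /(L_eigenvector vmu)[m [c [mum _ _]]].
by apply: none; exists m.
Qed.

Lemma one_neq0 : one != 0.
Proof. by apply/eqP => h; move/eqP: L_form_one; rewrite h (sesq0l fs) eq_sym oner_eq0. Qed.

Lemma L_irreducible : irreducible Lact.
Proof.
split; first by exists one; exact: one_neq0.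
move=> W Wst; have [h|] := pselect (forall v, v \in W -> v = 0); first by left.
move=> /existsNP[v /not_implyP[vW v0]]; right.
(* Nondegeneracy and invariance give an element w of W that pairs nontrivially with [one], hence has
   a component along it. *)
have [u hu] : exists u, form u v <> 0.
  by apply/existsNP => h; apply: v0; exact: L_form_nondegenerate.
have [x ux] := L_cyclic u; move: hu; rewrite ux -[x]starK -fi.
set w := Lact (star x) v => fw; have wW : w \in W by exact: Wst.
suff oneW : one \in W by move=> z; have [y ->] := L_cyclic z; exact: Wst.
(* Applying b - [n] removes the n-th component and keeps the one along [one]. *)
have extract (s : seq int) : 0 \notin s -> forall (g : int -> C) c, c != 0 ->
    c *: one + \sum_(n <- s) g n *: ev n \in W -> one \in W.
  elim: s => [_|n s IH] /=.
    by move=> g c c0; rewrite big_nil addr0 => /(rpredZ c^-1); rewrite scalerA mulVf // scale1r.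
  rewrite in_cons negb_or eq_sym => /andP[n0 s0] g c c0 sW.
  pose d m := (qnum q (weight_at b m))%:C - (qnum q (weight_at b n))%:C : C.
  apply: (IH s0 (fun m => d m * g m) (d 0 * c)).
    rewrite mulf_neq0 // subr_eq0; apply: contra_neq n0.
    by move=> /complexI/(qnum_inj q_gt0 q_lt1)/weight_at_inj.
  suff -> : (d 0 * c) *: one + \sum_(m <- s) (d m * g m) *: ev m =
      Lact (ub - (qnum q (weight_at b n))%:C%:A) (c *: one + \sum_(m <- n :: s) g m *: ev m).
    exact: Wst.
  have dE m k : Lact (ub - (qnum q (weight_at b n))%:C%:A) (k *: ev m) = (d m * k) *: ev m.
    rewrite (actZr Lmod) (actDl Lmod) (actNl Lmod) (act_const Lmod) L_vec_wt.
    by rewrite -scalerBl scalerA mulrC.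
  rewrite -L_vec0 (actDr Lmod) dE -[Lact _ (\sum_(_ <- _) _)]/(actr Lmod _ _).
  rewrite linear_sum /= big_cons dE [d n]subrr mul0r scale0r add0r; congr (_ + _).
  by apply: eq_bigr => m _; rewrite dE.
have [s [g [us wE]]] := L_span w.
have s0 : 0 \in s.
  apply: contrapT => /negP s0; apply: fw.
  by rewrite -L_vec0 wE L_form_sum_r // (negPf s0) mul0r.
have g0 : g 0 != 0.
  apply/eqP => g0; apply: fw.
  by rewrite -L_vec0 wE L_form_sum_r // g0 rmorph0 mul0r mulr0.
apply: (extract (rem 0 s) _ g (g 0) g0); first by rewrite mem_rem_uniqF.
by move: wW; rewrite wE (big_rem 0 s0) /= L_vec0.
Qed.

Section Positive.
Hypothesis pos : forall n, 0 <= form (ev n) (ev n).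

Lemma L_form_sum (s : seq int) (g : int -> C) : uniq s ->
  form (\sum_(n <- s) g n *: ev n) (\sum_(n <- s) g n *: ev n) =
  \sum_(n <- s) g n * Num.conj (g n) * form (ev n) (ev n).
Proof.
move=> us; set v := \sum_(n <- s) _.
have suml r : form (\sum_(n <- r) g n *: ev n) v = \sum_(n <- r) g n * form (ev n) v.
  elim: r => [|n r IH]; first by rewrite !big_nil (sesq0l fs).
  by rewrite !big_cons (sesqDl fs) (sesqZl fs) IH.
rewrite {1}/v suml big_seq [RHS]big_seq; apply: eq_bigr => n ns.
by rewrite L_form_sum_r // ns mul1r mulrA.
Qed.

Lemma L_form_gt0 v : v != 0 -> 0 < form v v.
Proof.
have [s [g [us ->]]] := L_span v => v0; rewrite L_form_sum //.
have pos' n : 0 <= g n * Num.conj (g n) * form (ev n) (ev n).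
  by rewrite mulr_ge0 // -normCK exprn_ge0.
rewrite lt0r sumr_ge0 ?andbT //; apply: contraNneq v0 => /eqP.
rewrite psumr_eq0 // => /allP h; rewrite big_seq big1 // => n /h /=.
rewrite !mulf_eq0 conjC_eq0 orbb => /orP[/eqP->|/eqP/L_vec_null->].
  by rewrite scale0r.
by rewrite scaler0.
Qed.

Lemma L_dot : exists ip : {dot L for Num.conj}, forall u v, ip u v = form u v.
Proof.
have bil : bilinear_for *%R (Num.conj \; *%R) form.
  by split; [exact: (fs.1) | exact: (fs.2)].
have herm u v : form u v = (-1) ^+ false * Num.conj (form v u).
  by rewrite mul1r; exact: L_form_herm.
pose ip : {dot L for Num.conj} := HB.pack form
  (bilinear_isBilinear.Build C L L C *%R (Num.conj \; *%R) form bil)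
  (isHermitianSesquilinear.Build C L false Num.conj form herm)
  (isDotProduct.Build C L form L_form_gt0).
by exists ip.
Qed.

End Positive.
End SimpleQuotient.

Section DotProducts.
Context {R : realType} {V : lmodType R[i]} (ip : {dot V for Num.conj}).

Lemma dot_sesquilinear : sesquilinear ip.
Proof. by split=> v c x y; [exact: linearPl | exact: linearPr]. Qed.

Lemma dot_gt0 v : v != 0 -> 0 < ip v v.
Proof. exact: neq0_dnorm_gt0. Qed.

Lemma dot_ge0 v : 0 <= ip v v.
Proof.
have [->|/dot_gt0/ltW//] := eqVneq v 0.
by rewrite (sesq0l dot_sesquilinear).
Qed.

End DotProducts.

(** * Identification of a representation with L, and signs along the ladder *)

Section Equivalence.
Context {R : realType} (q a t lam b : R).
Hypotheses (q_gt0 : 0 < q) (q_lt1 : q < 1) (ta : t = q `^ a - q `^ (- a)).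
Local Notation U := (U q t).
Local Notation C := R[i].
Local Notation ub := (ub q t).
Local Notation uO := (uO q t).
Local Notation L := (L q t lam b).
Local Notation Lact := (@L_act R q t lam b).
Local Notation form := (@L_form R q t lam b).
Local Notation one := (@L_one R q t lam b).
Local Notation ev := (@L_vec R q t lam b).

Let Lmod := @L_module R q a t lam b q_gt0 q_lt1 ta.
Let fs := @L_form_sesquilinear R q a t lam b q_gt0 q_lt1 ta.
Let fi := @L_form_invariant R q a t lam b q_gt0 q_lt1 ta.
Let one_wt := @L_one_wt R q a t lam b q_gt0 q_lt1 ta.
Let one_cas := @L_one_cas R q a t lam b q_gt0 q_lt1 ta.
Let form1 := @L_form_one R q a t lam b q_gt0 q_lt1 ta.

Let vec0 := @L_vec0 R q a t lam b q_gt0 q_lt1 ta.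

Section Cyclic.
Context {V : lmodType C} {act : U -> V -> V} {ip : {dot V for Num.conj}} (v0 : V).
Hypotheses (Vmod : is_module act) (Vinv : star_invariant act ip) (Virr : irreducible act).
Hypotheses (v0_wt : wt (act := act) b v0) (v0_cas : act uO v0 = lam%:C *: v0).
Hypothesis (v01 : ip v0 v0 = 1).

Let v00 : v0 != 0.
Proof.
apply/eqP => h; move/eqP: v01.
by rewrite h (sesq0l (dot_sesquilinear ip)) eq_sym oner_eq0.
Qed.

Lemma form_transport u w : form (Lact u one) (Lact w one) = ip (act u v0) (act w v0).
Proof.
rewrite (form_unique q_gt0 q_lt1 ta Lmod fs fi one_wt one_cas form1).
by rewrite (form_unique q_gt0 q_lt1 ta Vmod (dot_sesquilinear ip) Vinv v0_wt v0_cas v01).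
Qed.

(** Both annihilators are the radical of the same state: on V because [ip] is positive definite, on
    L because its form is nondegenerate. *)
Lemma transport_kill u : act u v0 = 0 <-> Lact u one = 0.
Proof.
split=> h; last first.
  apply/eqP; apply: contraT => /(dot_gt0 ip).
  by rewrite -form_transport h (sesq0l fs) ltxx.
apply: (@L_form_nondegenerate R q a t lam b q_gt0 q_lt1 ta) => x.
have [w ->] := @L_cyclic R q a t lam b q_gt0 q_lt1 ta x.
by rewrite form_transport h (sesq0r (dot_sesquilinear ip)).
Qed.

Lemma transport_eq u w : act u v0 = act w v0 <-> Lact u one = Lact w one.
Proof.
split=> h.
  apply/eqP; rewrite -subr_eq0 -(actNl Lmod) -(actDl Lmod); apply/eqP/transport_kill.
  by rewrite (actDl Vmod) (actNl Vmod) h subrr.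
apply/eqP; rewrite -subr_eq0 -(actNl Vmod) -(actDl Vmod); apply/eqP/transport_kill.
by rewrite (actDl Lmod) (actNl Lmod) h subrr.
Qed.

Lemma L_equiv : unitarily_equivalent act ip Lact form.
Proof.
have [r rE] := choice (irreducible_cyclic Vmod Virr v00).
have [s sE] := choice (@L_cyclic R q a t lam b q_gt0 q_lt1 ta).
(* Both maps use chosen elements of U; [transport_eq] makes the results independent of the
   choice. *)
pose f v := Lact (r v) one; pose g x := act (s x) v0.
have fE u : f (act u v0) = Lact u one by apply/transport_eq; rewrite rE.
have f_lin : linear f.
  move=> c v w; rewrite -[v]rE -[w]rE -(actZl Vmod) -(actDl Vmod) !fE.
  by rewrite (actDl Lmod) (actZl Lmod).
pose phi : {linear V -> L} := HB.pack f (GRing.isLinear.Build C V L _ f f_lin).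
exists phi.
  exists g => [v|x] /=; rewrite /g; last by rewrite fE -sE.
  exact: etrans ((transport_eq (s (f v)) (r v)).2 (esym (sE (f v)))) (rE v).
split=> [x v|u v] /=.
  by rewrite -[v]rE -(actM Vmod) !fE (actM Lmod).
by rewrite -[u]rE -[v]rE !fE form_transport.
Qed.

End Cyclic.

Lemma L_vecS (k : nat) : ev (Posz k + 1) = Lact (up q t (weight_at b k)) (ev k).
Proof. by rewrite /L_vec /e ladderS (actM Lmod). Qed.

Lemma L_vecP (k : nat) :
  ev (- Posz k - 1) = Lact (dn q t (weight_at b (- Posz k))) (ev (- Posz k)).
Proof. by rewrite /L_vec /e ladderP (actM Lmod). Qed.

Lemma L_norm_up (k : nat) : form (ev (Posz k + 1)) (ev (Posz k + 1)) =
  (qbrace q (weight_at b k) / qbrace q (weight_at b k + 2)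
     * norm_factor q a lam (weight_at b k))%:C * form (ev k) (ev k).
Proof.
rewrite L_vecS; have cas := @L_casimir R q a t lam b q_gt0 q_lt1 ta.
have wtk := @L_vec_wt R q a t lam b q_gt0 q_lt1 ta (Posz k).
exact: (norm_up q_gt0 q_lt1 ta Lmod fs fi wtk (cas _)).
Qed.

Lemma L_norm_dn (k : nat) : form (ev (- Posz k - 1)) (ev (- Posz k - 1)) =
  (qbrace q (weight_at b (- Posz k)) / qbrace q (weight_at b (- Posz k) - 2)
     * norm_factor q a lam (weight_at b (- Posz k) - 2))%:C
  * form (ev (- Posz k)) (ev (- Posz k)).
Proof.
rewrite L_vecP; have cas := @L_casimir R q a t lam b q_gt0 q_lt1 ta.
have wtk := @L_vec_wt R q a t lam b q_gt0 q_lt1 ta (- Posz k).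
exact: (norm_dn q_gt0 q_lt1 ta Lmod fs fi wtk (cas _)).
Qed.

Lemma L_vec_up0 : norm_factor q a lam b = 0 -> forall k : nat, ev (Posz k + 1) = 0.
Proof.
move=> h; elim=> [|k IH]; last first.
  by rewrite L_vecS -addn1 PoszD IH (act0r Lmod).
apply: (@L_vec_null R q a t lam b q_gt0 q_lt1 ta).
by rewrite L_norm_up weight_at0 h mulr0 mul0r.
Qed.

Lemma L_vec_dn0 : norm_factor q a lam (b - 2) = 0 -> forall k : nat, ev (- Posz k - 1) = 0.
Proof.
move=> h; elim=> [|k IH]; last first.
  by rewrite L_vecP -addn1 PoszD opprD IH (act0r Lmod).
apply: (@L_vec_null R q a t lam b q_gt0 q_lt1 ta).
by rewrite L_norm_dn oppr0 weight_at0 h mulr0 mul0r.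
Qed.

Let real_ge0 (x y r : R) : 0 <= r -> 0 <= (qbrace q x / qbrace q y * r)%:C :> C.
Proof. by move=> r0; rewrite ler0c mulr_ge0 // divr_ge0 // ltW // qbrace_gt0. Qed.

(** In each direction either the ladder stops at b, so that all further vectors vanish, or every
    step multiplies the norm by a nonnegative factor. *)
Lemma L_positive :
  norm_factor q a lam b = 0 \/
    (forall k : nat, 0 <= norm_factor q a lam (weight_at b k)) ->
  norm_factor q a lam (b - 2) = 0 \/
    (forall k : nat, 0 <= norm_factor q a lam (weight_at b (- Posz k) - 2)) ->
  forall n, 0 <= form (ev n) (ev n).
Proof.
move=> hup hdn n; case: (signP n) => k.
  case: hup => [/L_vec_up0 h|h].
    case: k => [|k]; first by rewrite vec0 form1.
    by rewrite -addn1 PoszD h (sesq0l fs).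
  elim: k => [|k IH]; first by rewrite vec0 form1.
  by rewrite -addn1 PoszD L_norm_up mulr_ge0 // real_ge0.
case: hdn => [/L_vec_dn0 ->|h]; first by rewrite (sesq0l fs).
suff {k} : forall k : nat, 0 <= form (ev (- Posz k)) (ev (- Posz k)).
  by move/(_ k.+1); rewrite -addn1 PoszD opprD.
elim=> [|k IH]; first by rewrite oppr0 vec0 form1.
by rewrite -addn1 PoszD opprD L_norm_dn mulr_ge0 // real_ge0.
Qed.

Lemma L_vec_neq0 n : ev n != 0 ->
  ((0 < n)%R -> norm_factor q a lam b <> 0) /\
  ((n < 0)%R -> norm_factor q a lam (b - 2) <> 0).
Proof.
case: (signP n) => k nz; split=> hn h.
- by case: k nz hn => [|k] nz // _; move: nz; rewrite -addn1 PoszD L_vec_up0 // eqxx.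
- by move: hn; rewrite ltz_nat.
- by move: hn; rewrite -opprD -PoszD oppr_gt0 ltz_nat.
- by move: nz; rewrite L_vec_dn0 // eqxx.
Qed.

End Equivalence.

(** * Classification *)

Section LabelArithmetic.
Context {R : realType} (q a : R).
Hypotheses (q_gt0 : 0 < q) (q_lt1 : q < 1).
Local Notation nf := (norm_factor q a).
Local Notation qbrace := (qbrace q).

(** Turns comparisons of q-braces into polynomial inequalities, which [nra] can settle. *)
Lemma qbrace_le_sqr (x y : R) : (qbrace x <= qbrace y) = (0 <= (y - x) * (y + x)).
Proof.
rewrite qbrace_le // -ler_sqr ?nnegrE // !real_normK ?num_real //.
by rewrite -subr_ge0 subr_sqr.
Qed.

(** Integrality in a form that [lra] and [nra] can use. *)
Lemma int_cases (n : int) : n = 0 \/ 1 <= n%:~R :> R \/ n%:~R <= -1 :> R.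
Proof.
have [->|n0] := eqVneq n 0; [by left | right].
have [n0'|n0'] := ltP 0 n; [left | right].
  by rewrite ler1z -gtz0_ge1.
have : 0 < - n by rewrite oppr_gt0 lt_neqAle n0.
rewrite gtz0_ge1 -(ler1z R) rmorphN /=; lra.
Qed.

Lemma principal_pos_plus lam s (n : int) : 0 <= s < 1 -> (exists k : int, a + s = k%:~R) ->
  - (q `^ (1 - 2 * s) + q `^ (2 * s - 1)) < lam < q^-1 + q ->
  0 < nf lam (a + 2 * n%:~R).
Proof.
move=> /andP[s0 s1] [k ak] /andP[lo]; rewrite -(qbrace1 q_gt0) => hi.
have {}lo : - lam < qbrace (1 - 2 * s) by rewrite ltrNl /qbrace opprB.
rewrite mulr_gt0 //.
  rewrite subr_gt0 (lt_le_trans hi) // qbrace_le_sqr.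
  by have [->|[h|h]] := int_cases n; nra.
rewrite -ltrBlDr sub0r (lt_le_trans lo) // qbrace_le_sqr.
(* Since |1 - 2s| <= 1, adding an even integer to 1 - 2s cannot decrease its absolute value. *)
have -> : a + 2 * n%:~R + a + 1 = 1 - 2 * s + 2 * (k + n)%:~R by rewrite intrD -ak; ring.
have [->|[h|h]] := int_cases (k + n); nra.
Qed.

Lemma principal_pos_minus lam s (n : int) : 0 <= s < 1 ->
  (exists k : int, a + s = 1 / 2 + k%:~R) ->
  - (q `^ (1 - 2 * s) + q `^ (2 * s - 1)) < lam < 2 ->
  0 < nf lam (a - 1 + 2 * n%:~R).
Proof.
move=> /andP[s0 s1] [k ak] /andP[lo hi].
have {}hi : lam < qbrace 0 by rewrite /qbrace oppr0 powRr0.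
have {}lo : - lam < qbrace (1 - 2 * s) by rewrite ltrNl /qbrace opprB.
rewrite mulr_gt0 //.
  by rewrite subr_gt0 (lt_le_trans hi) // qbrace_le_sqr; nra.
rewrite -ltrBlDr sub0r (lt_le_trans lo) // qbrace_le_sqr.
have -> : a - 1 + 2 * n%:~R + a + 1 = 1 - 2 * s + 2 * (k + n)%:~R.
  by rewrite intrD; lra.
have [->|[h|h]] := int_cases (k + n); nra.
Qed.

Lemma principal_label_plus lam : (forall n : int, 0 < nf lam (a + 2 * n%:~R)) ->
  label_valid q a (Lplus lam).
Proof.
move=> pos; have /andP[fl fu] := floor_itv (- a); set k := Num.floor (- a) in fl fu.
(* This s is the fractional part of -a. Index 0 of the hypothesis gives the upper bound on lam,
   index k the lower one. *)
exists (- k%:~R - a); move: fu; rewrite intrD => fu.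
split; first by apply/andP; split; lra.
  by exists (- k); rewrite rmorphN /=; ring.
have h0 := pos 0; have hk := pos k; move: h0 hk.
rewrite /norm_factor mulr0 !addr0 subrr add0r -qbrace1 //.
have -> : a + 2 * k%:~R + a + 1 = 1 - 2 * (- k%:~R - a) by ring.
set s := - k%:~R - a; set j := _ - a + 1.
have -> : q `^ (1 - 2 * s) + q `^ (2 * s - 1) = qbrace (1 - 2 * s).
  by rewrite /qbrace opprB.
have p1 := qbrace_gt0 q_gt0 1; have p2 := qbrace_gt0 q_gt0 (1 - 2 * s).
have p3 := qbrace_gt0 q_gt0 j; have p4 := qbrace_gt0 q_gt0 (a + a + 1).
(* If a bound fails, the sign of lam makes the other factor positive, so the product cannot be. *)
by move=> h1 h2; apply/andP; split; rewrite ltNge; apply/negP => h; nra.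
Qed.

Lemma principal_label_minus lam : (forall n : int, 0 < nf lam (a - 1 + 2 * n%:~R)) ->
  label_valid q a (Lminus lam).
Proof.
move=> pos; have /andP[fl fu] := floor_itv (1 / 2 - a).
set k := Num.floor (1 / 2 - a) in fl fu.
(* Here s is the fractional part of 1/2 - a; again index 0 bounds lam from above and index k from
   below. *)
exists (1 / 2 - k%:~R - a); move: fu; rewrite intrD => fu.
split; first by apply/andP; split; lra.
  by exists (- k); rewrite rmorphN /=; ring.
have h0 := pos 0; have hk := pos k; move: h0 hk.
rewrite /norm_factor mulr0 !addr0.
have -> : a - 1 - a + 1 = 0 by ring.
have -> : a - 1 + 2 * k%:~R + a + 1 = 1 - 2 * (1 / 2 - k%:~R - a) by field.
set s := 1 / 2 - k%:~R - a; set j := _ - a + 1; set i := a - 1 + a + 1.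
have -> : q `^ (1 - 2 * s) + q `^ (2 * s - 1) = qbrace (1 - 2 * s).
  by rewrite /qbrace opprB.
have -> : qbrace 0 = 2 by rewrite /qbrace oppr0 powRr0.
have p2 := qbrace_gt0 q_gt0 (1 - 2 * s).
have p3 := qbrace_gt0 q_gt0 j; have p4 := qbrace_gt0 q_gt0 i.
by move=> h1 h2; apply/andP; split; rewrite ltNge; apply/negP => h; nra.
Qed.

Lemma qbrace1E : q^-1 + q = qbrace 1.
Proof. by rewrite qbrace1. Qed.

Definition has_label (lam b : R) : Prop :=
  exists l : label R, [/\ label_valid q a l, label_lambda q a l = lam & label_b a l = b].

(** The vanishing factor leaves lam = {m-1} or lam = -{2a+m-1}. The next factor is nonnegative
    exactly when m >= 0, respectively 2a + m >= 0. Strict inequality gives D^+ or E^+, equality a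
    one-dimensional module. *)
Lemma lowest_label lam (m : int) :
  nf lam (a + m%:~R - 2) = 0 -> 0 <= nf lam (a + m%:~R) -> has_label lam (a + m%:~R).
Proof.
rewrite /norm_factor.
have -> : a + m%:~R - 2 - a + 1 = m%:~R - 1 by ring.
have -> : a + m%:~R - 2 + a + 1 = 2 * a + m%:~R - 1 by ring.
have -> : a + m%:~R - a + 1 = m%:~R + 1 by ring.
have -> : a + m%:~R + a + 1 = 2 * a + m%:~R + 1 by ring.
have p x := qbrace_gt0 q_gt0 x.
move=> /eqP; rewrite mulf_eq0 => /orP[|]; rewrite ?subr_eq0 ?addr_eq0 => /eqP h.
  rewrite -h pmulr_lge0; last by rewrite addr_gt0.
  rewrite subr_ge0 qbrace_le_sqr => hm.
  have : 0 <= m%:~R :> R by nra.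
  rewrite le_eqVlt => /predU1P[m0|m0]; last first.
    by exists (Dplus _ m); split; rewrite //= -(ltr0z R).
  exists (@Triv R); split; rewrite //= -?m0 ?addr0 // qbrace1E.
  by rewrite sub0r qbraceN.
have {}h : lam = - qbrace (2 * a + m%:~R - 1) by rewrite h opprK.
rewrite h opprK pmulr_rge0; last by rewrite addr_gt0.
rewrite subr_ge0 qbrace_le_sqr => hm.
have : 0 <= 2 * a + m%:~R by nra.
rewrite le_eqVlt => /predU1P[m0|m0]; last first.
  by exists (Eplus _ m); split; rewrite //=; lra.
exists (@Char R); split; rewrite /=.
- by exists (- m); rewrite rmorphN /=; lra.
- by rewrite qbrace1E -m0 sub0r qbraceN.
- by lra.
Qed.

(** Mirror image of [lowest_label]: as {-x} = {x}, the factors become those for -a in place of a. *)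
Lemma highest_label lam (m : int) :
  nf lam (a - m%:~R) = 0 -> 0 <= nf lam (a - m%:~R - 2) -> has_label lam (a - m%:~R).
Proof.
rewrite /norm_factor.
have -> : a - m%:~R - 2 - a + 1 = - (m%:~R + 1) by ring.
have -> : a - m%:~R - 2 + a + 1 = - (- (2 * a) + m%:~R + 1) by ring.
have -> : a - m%:~R - a + 1 = - (m%:~R - 1) by ring.
have -> : a - m%:~R + a + 1 = - (- (2 * a) + m%:~R - 1) by ring.
rewrite !qbraceN.
have p x := qbrace_gt0 q_gt0 x.
move=> /eqP; rewrite mulf_eq0 => /orP[|]; rewrite ?subr_eq0 ?addr_eq0 => /eqP h.
  rewrite -h pmulr_lge0; last by rewrite addr_gt0.
  rewrite subr_ge0 qbrace_le_sqr => hm.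
  have : 0 <= m%:~R :> R by nra.
  rewrite le_eqVlt => /predU1P[m0|m0]; last first.
    by exists (Dminus _ m); split; rewrite //= -(ltr0z R).
  exists (@Triv R); split; rewrite //= -?m0 ?subr0 // qbrace1E.
  by rewrite sub0r qbraceN.
have {}h : lam = - qbrace (- (2 * a) + m%:~R - 1) by rewrite h opprK.
rewrite h opprK pmulr_rge0; last by rewrite addr_gt0.
rewrite subr_ge0 qbrace_le_sqr => hm.
have : 0 <= - (2 * a) + m%:~R by nra.
rewrite le_eqVlt => /predU1P[m0|m0]; last first.
  by exists (Eminus _ m); split; rewrite //=; lra.
exists (@Char R); split; rewrite /=.
- by exists m; lra.
- by rewrite qbrace1E -m0 sub0r qbraceN.
- by lra.
Qed.

(** The series whose [label_b] is the lowest weight of the module. The one-dimensional modules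
    belong to both lists. *)
Definition has_lowest (l : label R) : Prop :=
  match l with Dplus _ | Eplus _ | Triv | Char => True | _ => False end.
Definition has_highest (l : label R) : Prop :=
  match l with Dminus _ | Eminus _ | Triv | Char => True | _ => False end.

Lemma lowest_factor0 l : has_lowest l -> nf (label_lambda q a l) (label_b a l - 2) = 0.
Proof.
case: l => //= [n|n||] _; rewrite /norm_factor ?qbrace1E.
- by rewrite (_ : _ - a + 1 = n%:~R - 1) ?subrr ?mul0r //; ring.
- by rewrite (_ : a + n%:~R - 2 + a + 1 = 2 * a + n%:~R - 1) ?subrr ?mulr0 //; ring.
- by rewrite (_ : a - 2 - a + 1 = - 1) ?qbraceN ?subrr ?mul0r //; ring.
- by rewrite (_ : - a - 2 + a + 1 = - 1) ?qbraceN ?subrr ?mulr0 //; ring.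
Qed.

Lemma highest_factor0 l : has_highest l -> nf (label_lambda q a l) (label_b a l) = 0.
Proof.
case: l => //= [n|n||] _; rewrite /norm_factor ?qbrace1E.
- by rewrite (_ : _ - a + 1 = - (n%:~R - 1)) ?qbraceN ?subrr ?mul0r //; ring.
- by rewrite (_ : a - n%:~R + a + 1 = - (- (2 * a) + n%:~R - 1)) ?qbraceN ?subrr ?mulr0 //; ring.
- by rewrite (_ : a - a + 1 = 1) ?subrr ?mul0r //; ring.
- by rewrite (_ : - a + a + 1 = 1) ?subrr ?mulr0 //; ring.
Qed.

Lemma label_factor_ge0 l : label_valid q a l ->
  let lam := label_lambda q a l in let b := label_b a l in
  (nf lam b = 0 \/ forall k : nat, 0 <= nf lam (weight_at b k)) /\
  (nf lam (b - 2) = 0 \/ forall k : nat, 0 <= nf lam (weight_at b (- Posz k) - 2)).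
Proof.
have p x := qbrace_gt0 q_gt0 x.
have k0 (k : nat) : 0 <= (Posz k)%:~R :> R by rewrite ler0z.
have g0 (n : int) : 0 < n -> 1 <= n%:~R :> R by rewrite ler1z -gtz0_ge1.
case: l => [lam|lam|n|n|n|n||] /=.
- move=> [s [hs hk hl]]; have pos n := principal_pos_plus n hs hk hl.
  split; right=> k; first exact/ltW/pos.
  have := pos (- Posz k - 1); rewrite intrB /weight_at => /ltW.
  by rewrite (_ : a + 2 * _ = a + 2 * (- Posz k)%:~R - 2) //; ring.
- move=> [s [hs hk hl]]; have pos n := principal_pos_minus n hs hk hl.
  split; right=> k; first exact/ltW/pos.
  have := pos (- Posz k - 1); rewrite intrB /weight_at => /ltW.
  by rewrite (_ : a - 1 + 2 * _ = a - 1 + 2 * (- Posz k)%:~R - 2) //; ring.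
- move=> /g0 n1; split; [right=> k|left; exact: (lowest_factor0 (l := Dplus R n))].
  apply: mulr_ge0; last by rewrite addr_ge0 ?ltW.
  rewrite subr_ge0 qbrace_le_sqr /weight_at.
  by have := k0 k; set x := _%:~R => x0; apply: mulr_ge0; lra.
- move=> n1; split; [right=> k|left; exact: (lowest_factor0 (l := Eplus R n))].
  apply: mulr_ge0; first by rewrite opprK addr_ge0 ?ltW.
  rewrite subr_ge0 qbrace_le_sqr /weight_at.
  by have := k0 k; set x := _%:~R => x0; apply: mulr_ge0; lra.
- move=> /g0 n1; split; [left; exact: (highest_factor0 (l := Dminus R n))|right=> k].
  apply: mulr_ge0; last by rewrite addr_ge0 ?ltW.
  rewrite subr_ge0 qbrace_le_sqr /weight_at.
  by have := k0 k; rewrite rmorphN /=; set x := _%:~R => x0; apply: mulr_le0; lra.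
- move=> n1; split; [left; exact: (highest_factor0 (l := Eminus R n))|right=> k].
  apply: mulr_ge0; first by rewrite opprK addr_ge0 ?ltW.
  rewrite subr_ge0 qbrace_le_sqr /weight_at.
  by have := k0 k; rewrite rmorphN /=; set x := _%:~R => x0; apply: mulr_le0; lra.
- by move=> _; split; left; [exact: (highest_factor0 (l := Triv)) | exact: (lowest_factor0 (l := Triv))].
- by move=> _; split; left; [exact: (highest_factor0 (l := Char)) | exact: (lowest_factor0 (l := Char))].
Qed.

Lemma label_b_class l : label_valid q a l -> exists k : int, label_b a l = a + k%:~R.
Proof.
case: l => [lam|lam|n|n|n|n||] /=.
- by exists 0; rewrite addr0.
- by exists (- 1).
- by exists n.
- by exists n.
- by exists (- n); rewrite rmorphN.
- by exists (- n); rewrite rmorphN.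
- by exists 0; rewrite addr0.
- by move=> [k ak]; exists (- k); rewrite rmorphN /=; lra.
Qed.

End LabelArithmetic.

(** * A Casimir eigenvector inside a weight space *)

Section CasimirEigenvector.
Context {R : realType} (q t : R).
Hypotheses (q_gt0 : 0 < q) (q_lt1 : q < 1).
Local Notation U := (U q t).
Local Notation C := R[i].
Local Notation uO := (uO q t).
Context {V : lmodType C} {act : U -> V -> V} (Vmod : is_module act).

(** Dropping factors from the left, one meets a tail u of the product with u w nonzero and killed by
    the next factor. Centrality of u is recorded so that u w keeps the weight of w. *)
Lemma poly_kill_eigenvector (s : seq C) (w : V) : w != 0 ->
  act (\prod_(z <- s) (uO - z%:A)) w = 0 ->
  exists mu u, [/\ act u w != 0, forall v, u * v = v * u & act uO (act u w) = mu *: act u w].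
Proof.
move=> w0; elim: s => [|z s IH]; first by rewrite big_nil (act1 Vmod) => /eqP; rewrite (negPf w0).
rewrite big_cons (actM Vmod); set u := \prod_(_ <- _) _.
have [/IH//|u0] := eqVneq (act u w) 0.
rewrite (actDl Vmod) (actNl Vmod) (act_const Vmod) => /eqP; rewrite subr_eq0 => /eqP E.
exists z, u; split=> // v; rewrite /u; elim: (s) => [|y r IHr]; first by rewrite big_nil mul1r mulr1.
rewrite big_cons -mulrA IHr !mulrA; congr (_ * _).
by rewrite mulrBl mulrBr mulr_algl mulr_algr uO_central.
Qed.

(** The Casimir element preserves the weight space, so n + 1 of its powers applied to w are
    dependent; the resulting polynomial splits over [R[i]]. *)
Lemma casimir_eigenvector (c : R) (w : V) (n : nat) (f : 'I_n -> V) :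
  w != 0 -> wt (act := act) c w ->
  (forall v, wt (act := act) c v -> exists g : 'I_n -> C, v = \sum_k g k *: f k) ->
  exists mu v, [/\ v != 0, wt (act := act) c v & act uO v = mu *: v].
Proof.
move=> w0 wc fin.
have Twt (u : U) : (forall v, u * v = v * u) -> wt (act := act) c (act u w).
  by move=> cu; rewrite /wt -(actM Vmod) -cu (actM Vmod) wc (actZr Vmod).
have cX i v : uO ^+ i * v = v * uO ^+ i.
  by apply: esym; apply: commrX; exact: esym (uO_central q_gt0 v).
have /choice[g gE] (i : 'I_n.+1) : exists g : 'I_n -> C, act (uO ^+ i) w = \sum_k g k *: f k.
  exact/fin/Twt/cX.
pose G := \matrix_(i < n.+1, k < n) g i k.
(* A matrix with n + 1 rows and n columns has a nonzero row vector in its left kernel; its entries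
   are the coefficients of P. *)
have /rowV0Pn[r /sub_kermxP rG r0] : kermx G != 0.
  by rewrite -mxrank_eq0 mxrank_ker subn_eq0 -ltnNge ltnS rank_leq_col.
pose P := \poly_(i < n.+1) r 0 (inord i).
have P0 : P != 0.
  apply: contraNneq r0 => P0; apply/eqP/rowP => i; rewrite mxE.
  have := congr1 (fun p : {poly C} => p`_i) P0.
  by rewrite coef_poly coef0 ltn_ord inord_val.
have PE : act (horner_alg uO P) w = 0.
  rewrite /P poly_def linear_sum /= -[act _ w]/(actl Vmod w _) linear_sum /=.
  transitivity (\sum_(k < n) (r *m G) 0 k *: f k); last first.
    by rewrite rG big1 // => k _; rewrite mxE scale0r.
  transitivity (\sum_(i < n.+1) \sum_k (r 0 i * g i k) *: f k).
    apply: eq_bigr => i _; rewrite linearZ /= rmorphXn /= horner_algX.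
    rewrite mulr_algl (actZl Vmod) gE inord_val.
    by rewrite scaler_sumr; apply: eq_bigr => k _; rewrite scalerA.
  rewrite exchange_big /=; apply: eq_bigr => k _.
  by rewrite mxE scaler_suml; apply: eq_bigr => i _; rewrite mxE.
have [s sE] := closed_field_poly_normal P.
have [|mu [u [u0 uc uO_E]]] := @poly_kill_eigenvector s w w0.
  move: PE; rewrite sE linearZ /= rmorph_prod /= mulr_algl (actZl Vmod) => /eqP.
  rewrite scaler_eq0 lead_coef_eq0 (negPf P0) /= => /eqP <-; congr (act _ w).
  by apply: eq_bigr => z _; rewrite rmorphB /= horner_algX horner_algC.
by exists mu, (act u w); split=> //; exact: Twt.
Qed.

End CasimirEigenvector.

(** * Different labels give inequivalent modules *)

Section LabelsDistinct.
Context {R : realType} (q a : R).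
Hypotheses (q_gt0 : 0 < q) (q_lt1 : q < 1).
Local Notation nf := (norm_factor q a).
Local Notation qbrace := (qbrace q).
Local Notation lamb := (label_lambda q a).
Local Notation lab := (label_b a).
Local Notation valid := (label_valid q a).

Lemma half_not_int (n : int) : 2 * n%:~R <> 1 :> R.
Proof. by have [->|[h|h]] := @int_cases R n; lra. Qed.

(** All factors along a principal ladder are positive, while an extremal label would make one
    vanish; the other principal series is excluded by the parity of the weights. *)
Lemma plus_label_unique lam (l : label R) (n : int) :
  valid (Lplus lam) -> valid l -> lam = lamb l -> lab l = a + 2 * n%:~R -> l = Lplus lam.
Proof.
move=> [s [s1 sk sl]] vl ll lb.
have pos m := principal_pos_plus q_gt0 q_lt1 m s1 sk sl.
have nlow : ~ has_lowest l.
  move=> /(@lowest_factor0 R q a q_gt0); rewrite -ll lb => h.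
  have := pos (n - 1); rewrite intrB (_ : a + 2 * _ = a + 2 * n%:~R - 2) ?h ?ltxx //; ring.
have nhigh : ~ has_highest l.
  move=> /(@highest_factor0 R q a q_gt0); rewrite -ll lb => h.
  by have := pos n; rewrite h ltxx.
case: l vl ll lb nlow nhigh => //= [mu|mu] _ <- // lb _ _.
by case: (@half_not_int (- n)); rewrite rmorphN /=; lra.
Qed.

Lemma minus_label_unique lam (l : label R) (n : int) :
  valid (Lminus lam) -> valid l -> lam = lamb l -> lab l = a - 1 + 2 * n%:~R -> l = Lminus lam.
Proof.
move=> [s [s1 sk sl]] vl ll lb.
have pos m := principal_pos_minus q_gt0 q_lt1 m s1 sk sl.
have nlow : ~ has_lowest l.
  move=> /(@lowest_factor0 R q a q_gt0); rewrite -ll lb => h.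
  have := pos (n - 1); rewrite intrB (_ : a - 1 + 2 * _ = a - 1 + 2 * n%:~R - 2) ?h ?ltxx //; ring.
have nhigh : ~ has_highest l.
  move=> /(@highest_factor0 R q a q_gt0); rewrite -ll lb => h.
  by have := pos n; rewrite h ltxx.
case: l vl ll lb nlow nhigh => //= [mu|mu] _ <- // lb _ _.
by case: (@half_not_int n); lra.
Qed.

Lemma qbrace_eq_sqr (x y : R) : qbrace x = qbrace y -> (y - x) * (y + x) = 0.
Proof.
move=> h; apply/eqP; rewrite eq_le -(qbrace_le_sqr q_gt0 q_lt1) h lexx andbT.
by rewrite -oppr_ge0 -mulNr opprB [y + x]addrC -(qbrace_le_sqr q_gt0 q_lt1) h lexx.
Qed.

(** The four implications are what an equivalence yields when each label weight occurs in the other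
    module: neither ladder passes its own extremal weight. The sign of lam, the order of the weights
    and arithmetic within each series do the rest. *)
Lemma labels_distinct (l l' : label R) (n : int) :
  valid l -> valid l' -> lamb l = lamb l' -> lab l' = lab l + 2 * n%:~R ->
  (n < 0 -> ~ has_lowest l) -> (0 < n -> ~ has_highest l) ->
  (0 < n -> ~ has_lowest l') -> (n < 0 -> ~ has_highest l') -> l = l'.
Proof.
move=> vl vl' ll lb low high low' high'.
have lbN : lab l = lab l' + 2 * (- n)%:~R by rewrite lb rmorphN /=; ring.
have p x := qbrace_gt0 q_gt0 x.
have p1 : 0 < q^-1 + q by rewrite addr_gt0 ?invr_gt0.
have g0 (m : int) : 0 < m -> 1 <= m%:~R :> R by rewrite ler1z -gtz0_ge1.
have nn : n%:~R < 0 :> R -> n < 0 by rewrite ltrz0.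
have np : 0 < n%:~R :> R -> 0 < n by rewrite ltr0z.
have n_int := @int_cases R n.
have eqz (m k : int) : m%:~R = k%:~R :> R -> m = k by move/intr_inj.
case: l vl ll lb low high lbN => [lam|lam|m|m|m|m||] vl ll lb low high lbN.
- by rewrite (plus_label_unique vl vl' ll lb).
- by rewrite (minus_label_unique vl vl' ll lb).
all: case: l' vl' ll lb low' high' lbN => [lam|lam|k|k|k|k||] vl' ll lb low' high' lbN.
all: try by (first [ exact: (plus_label_unique vl' vl (esym ll) lbN)
                   | exact: (minus_label_unique vl' vl (esym ll) lbN) ]).
all: rewrite /= in vl vl' ll lb low high low' high'.
(* Different signs of lambda. *)
all: try by (exfalso; have := p (m%:~R - 1); have := p (k%:~R - 1); lra).
all: try by (exfalso; match goal with
  | H : - qbrace ?x = qbrace ?y |- _ => have := p x; have := p y; lra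
  | H : qbrace ?x = - qbrace ?y |- _ => have := p x; have := p y; lra
  | H : qbrace ?x = - (_ + _) |- _ => have := p x; lra
  | H : - qbrace ?x = _ + _ |- _ => have := p x; lra
  | H : _ + _ = - qbrace ?x |- _ => have := p x; lra
  | H : - (_ + _) = qbrace ?x |- _ => have := p x; lra
  | H : - (_ + _) = _ + _ |- _ => lra
  | H : _ + _ = - (_ + _) |- _ => lra
  end).
(* Incompatible lowest or highest weights. *)
all: try (have m1 := g0 m vl). all: try (have k1 := g0 k vl').
all: try by [].
all: try by (exfalso; apply: low => //; apply: nn; lra).
all: try by (exfalso; apply: high => //; apply: np; lra).
all: try by (exfalso; apply: low' => //; apply: np; lra).
all: try by (exfalso; apply: high' => //; apply: nn; lra).
(* Two labels of the same series. *)
all: try (move/oppr_inj in ll); have {ll} ll := qbrace_eq_sqr ll.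
all: congr (_ _); apply: eqz; have [n0|[h|h]] := n_int.
all: try rewrite n0 mulr0 addr0 in lb.
all: try nra.
Qed.

End LabelsDistinct.

(** * The classification of irreducible representations *)

Section Classification.
Context {R : realType} (q a t : R).
Hypotheses (q_gt0 : 0 < q) (q_lt1 : q < 1) (ta : t = q `^ a - q `^ (- a)).
Local Notation U := (U q t).
Local Notation C := R[i].
Local Notation ub := (ub q t).
Local Notation uO := (uO q t).
Local Notation nf := (norm_factor q a).

Section Representation.
Context {V : lmodType C} {act : U -> V -> V} {ip : {dot V for Num.conj}}.
Hypotheses (Vmod : is_module act) (Vinv : star_invariant act ip).
Let fs := dot_sesquilinear ip.

Lemma exists_weight_vector : admissible act -> spectrum_in a act -> (exists v : V, v != 0) ->
  exists (k : int) w, w != 0 /\ wt (act := act) (a + k%:~R) w.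
Proof.
move=> [diag _] spec [v v0]; have [n [f [mu [eig vE]]]] := diag v.
have [[k fk]|none] := pselect (exists k, f k != 0); last first.
  case/eqP: v0; rewrite vE big1 // => k _.
  by apply/eqP/negPn/negP => fk; apply: none; exists k.
have [m muE] := spec _ _ fk (eig k).
by exists m, (f k); split=> //; rewrite /wt ubE eig muE.
Qed.

Lemma casimir_real (mu : C) v : v != 0 -> act uO v = mu *: v -> exists lam : R, mu = lam%:C.
Proof.
move=> v0 vO; have := Vinv uO v v; rewrite star_uO vO (sesqZl fs) (sesqZr fs).
move/(mulIf (lt0r_neq0 (dot_gt0 ip v0)))/eqP; rewrite -CrealE => /complex_realP.
by [].
Qed.

Section Signs.
Variables (lam c : R) (v : V).
Hypotheses (v0 : v != 0) (vc : wt (act := act) c v) (vO : act uO v = lam%:C *: v).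

Let ratio_gt0 x y : 0 < qbrace q x / qbrace q y.
Proof. by rewrite divr_gt0 // qbrace_gt0. Qed.

Lemma up_factor_ge0 : 0 <= nf lam c.
Proof.
have := dot_ge0 ip (act (up q t c) v); rewrite (norm_up q_gt0 q_lt1 ta Vmod fs Vinv vc vO).
by rewrite pmulr_lge0 ?dot_gt0 // ler0c pmulr_rge0 ?ratio_gt0.
Qed.
Lemma dn_factor_ge0 : 0 <= nf lam (c - 2).
Proof.
have := dot_ge0 ip (act (dn q t c) v); rewrite (norm_dn q_gt0 q_lt1 ta Vmod fs Vinv vc vO).
by rewrite pmulr_lge0 ?dot_gt0 // ler0c pmulr_rge0 ?ratio_gt0.
Qed.
Lemma up_factor_gt0 : act (up q t c) v != 0 -> 0 < nf lam c.
Proof.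
move=> /(dot_gt0 ip); rewrite (norm_up q_gt0 q_lt1 ta Vmod fs Vinv vc vO).
by rewrite pmulr_lgt0 ?dot_gt0 // (ltcR 0) pmulr_rgt0 ?ratio_gt0.
Qed.
Lemma dn_factor_gt0 : act (dn q t c) v != 0 -> 0 < nf lam (c - 2).
Proof.
move=> /(dot_gt0 ip); rewrite (norm_dn q_gt0 q_lt1 ta Vmod fs Vinv vc vO).
by rewrite pmulr_lgt0 ?dot_gt0 // (ltcR 0) pmulr_rgt0 ?ratio_gt0.
Qed.
Lemma up_factor_eq0 : act (up q t c) v = 0 -> nf lam c = 0.
Proof.
move=> h; have := dn_up q_gt0 q_lt1 ta Vmod vc vO; rewrite h (act0r Vmod) => /esym/eqP.
by rewrite scaler_eq0 (negPf v0) orbF => /eqP/complexI.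
Qed.
Lemma dn_factor_eq0 : act (dn q t c) v = 0 -> nf lam (c - 2) = 0.
Proof.
move=> h; have := up_dn q_gt0 q_lt1 ta Vmod vc vO; rewrite h (act0r Vmod) => /esym/eqP.
by rewrite scaler_eq0 (negPf v0) orbF => /eqP/complexI.
Qed.
End Signs.

(** The given weight is usually not that of the label, so the labelled vector is sought elsewhere on
    the ladder of w: at its top, at its bottom, or, if it never stops, at weight a or a - 1. *)
Lemma labelled_vector lam (k : int) w : w != 0 ->
  wt (act := act) (a + k%:~R) w -> act uO w = lam%:C *: w ->
  exists (l : label R) v, [/\ label_valid q a l, label_lambda q a l = lam, v != 0,
    wt (act := act) (label_b a l) v & act uO v = lam%:C *: v].
Proof.
move=> w0 wc wO.
pose E := e (act := act) (a + k%:~R) w.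
have Ewt n : wt (act := act) (weight_at (a + k%:~R) n) (E n) := e_wt q_gt0 q_lt1 Vmod wc wO n.
have Ecas n : act uO (E n) = lam%:C *: E n := e_cas _ q_gt0 Vmod wO n.
have E0 : E 0 != 0 by rewrite /E e0E.
have ES (j : nat) : E (Posz j + 1) = act (up q t (weight_at (a + k%:~R) j)) (E j).
  by rewrite /E /e ladderS (actM Vmod).
have EP (j : nat) : E (- Posz j - 1) = act (dn q t (weight_at (a + k%:~R) (- Posz j))) (E (- Posz j)).
  by rewrite /E /e ladderP (actM Vmod).
have fin b n : has_label q a lam b -> E n != 0 -> weight_at (a + k%:~R) n = b ->
    exists (l : label R) v, [/\ label_valid q a l, label_lambda q a l = lam, v != 0,
      wt (act := act) (label_b a l) v & act uO v = lam%:C *: v].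
  by move=> [l [vl ll lb]] En nb; exists l, (E n); rewrite lb -nb.
have [[j [Ej ESj]]|up_all] := pselect (exists j : nat, E j != 0 /\ E (Posz j + 1) = 0).
  have bE : weight_at (a + k%:~R) j = a - (- (k + 2 * Posz j))%:~R.
    by rewrite /weight_at rmorphN opprK rmorphD rmorphM /=; ring.
  apply: (fin _ j _ Ej bE); rewrite -bE.
  have h0 := up_factor_eq0 Ej (Ewt _) (Ecas _) (etrans (esym (ES j)) ESj).
  have h1 := dn_factor_ge0 Ej (Ewt _) (Ecas _).
  by rewrite bE in h0 h1 *; exact: highest_label.
have Epos (j : nat) : E j != 0.
  elim: j => // j IH; apply/eqP => h; apply: up_all; exists j; split=> //.
  by rewrite -PoszD addn1.
have [[j [Ej ESj]]|dn_all] := pselect (exists j : nat, E (- Posz j) != 0 /\ E (- Posz j - 1) = 0).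
  have bE : weight_at (a + k%:~R) (- Posz j) = a + (k - 2 * Posz j)%:~R.
    by rewrite /weight_at rmorphN rmorphB rmorphM /=; ring.
  apply: (fin _ _ _ Ej bE); rewrite -bE.
  have h0 := dn_factor_eq0 Ej (Ewt _) (Ecas _) (etrans (esym (EP j)) ESj).
  have h1 := up_factor_ge0 Ej (Ewt _) (Ecas _).
  by rewrite bE in h0 h1 *; exact: lowest_label.
have Eneg (j : nat) : E (- Posz j) != 0.
  elim: j => [|j IH]; first by rewrite oppr0.
  apply/eqP => h; apply: dn_all; exists j; split=> //.
  by rewrite -opprD -PoszD addn1.
have Eall n : E n != 0.
  by case: (signP n) => j //; rewrite -opprD -PoszD addn1.
have pos n : 0 < nf lam (weight_at (a + k%:~R) n).
  case: (signP n) => j.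
    by apply: (up_factor_gt0 (Eall _) (Ewt _) (Ecas _)); rewrite -ES.
  by rewrite weight_atP; apply: (dn_factor_gt0 (Eall _) (Ewt _) (Ecas _)); rewrite -EP.
(* The ladder now meets every weight in a + k + 2Z; the parity of k decides whether a or a - 1 is
   among them. *)
have [m [km|km]] : exists m : int, k = 2 * m \/ k = 2 * m - 1.
  exists ((k + 1) %/ 2)%Z; have := divz_eq (k + 1) 2.
  have := modz_ge0 (k + 1) (isT : (2 : int) != 0).
  have := ltz_pmod (k + 1) (isT : 0 < (2 : int)).
  by move: ((k + 1) %% 2)%Z ((k + 1) %/ 2)%Z => r d; lia.
- apply: (fin a (- m)) => //; last by rewrite /weight_at km rmorphM rmorphN /=; ring.
  exists (Lplus lam); split=> //; apply: principal_label_plus => // n.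
  have := pos (n - m); congr (_ < nf _ _).
  by rewrite /weight_at km rmorphB rmorphM /=; ring.
- apply: (fin (a - 1) (- m)) => //.
    exists (Lminus lam); split=> //; apply: principal_label_minus => // n.
    have := pos (n - m); congr (_ < nf _ _).
    by rewrite /weight_at km !rmorphB rmorphM /=; ring.
  by rewrite /weight_at km rmorphB rmorphM rmorphN /=; ring.
Qed.

Lemma classification : admissible act -> spectrum_in a act -> irreducible act ->
  exists2 l : label R, label_valid q a l &
    unitarily_equivalent act ip (@L_act R q t (label_lambda q a l) (label_b a l))
      (@L_form R q t (label_lambda q a l) (label_b a l)).
Proof.
move=> adm spec irr; have [k [w [w0 wc]]] := exists_weight_vector adm spec irr.1.
have [n [f fin]] := adm.2 (qnum q (a + k%:~R))%:C.
have [|mu [v [v0 vc vO]]] := casimir_eigenvector q_gt0 Vmod (n := n) (f := f) w0 wc.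
  by move=> v vc; apply: fin; rewrite -ubE.
have [lam lamE] := casimir_real v0 vO; rewrite lamE in vO.
have [l [u [vl ll u0 ul uO_E]]] := labelled_vector v0 vc vO.
exists l => //; rewrite -ll in uO_E.
have uu := dot_gt0 ip u0; set r := sqrtC (ip u u).
have r0 : r != 0 by rewrite sqrtC_eq0 gt_eqF.
have rr : Num.conj r = r by apply/eqP; rewrite -CrealE ger0_real // sqrtC_ge0 ltW.
apply: (L_equiv q_gt0 q_lt1 ta (v0 := r^-1 *: u) Vmod Vinv irr).
- by rewrite /wt (actZr Vmod) ul !scalerA mulrC.
- by rewrite (actZr Vmod) uO_E !scalerA mulrC.
- rewrite (sesqZl fs) (sesqZr fs) fmorphV /= rr mulrA -expr2 exprVn sqrtCK.
  by rewrite mulVf // gt_eqF.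
Qed.

End Representation.

Lemma label_rep (l : label R) : label_valid q a l ->
  exists2 ip : {dot (L q t (label_lambda q a l) (label_b a l)) for Num.conj},
    SL2_admissible_irreducible_star_rep a
      (@L_act R q t (label_lambda q a l) (label_b a l)) ip &
    forall u v, ip u v = L_form u v.
Proof.
move=> vl; have [hup hdn] := label_factor_ge0 q_gt0 q_lt1 vl.
have [k bk] := label_b_class vl; move: hup hdn bk => /=.
move: (label_lambda q a l) (label_b a l) => lam b hup hdn bk.
have pos := L_positive q_gt0 q_lt1 ta hup hdn.
have [ip ipE] := L_dot q_gt0 q_lt1 ta pos.
exists ip => //; split.
- exact: (@L_module R q a t lam b q_gt0 q_lt1 ta).
- by move=> x u v; rewrite !ipE (@L_form_invariant R q a t lam b q_gt0 q_lt1 ta).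
- exact: (@L_admissible R q a t lam b q_gt0 q_lt1 ta).
- move=> mu v v0 vmu; have [n [c [-> _ _]]] := L_eigenvector q_gt0 q_lt1 ta vmu v0.
  exists (k + 2 * n); congr (_%:C); congr qnum.
  by rewrite /weight_at bk rmorphD rmorphM /=; ring.
- exact: (@L_irreducible R q a t lam b q_gt0 q_lt1 ta).
Qed.

(** Each vacuum is carried to a weight vector of the other module, so its weight is that of a
    nonzero ladder vector there; reaching such a vector means that the ladder is not cut at its own
    starting point in that direction. *)
Lemma equivalent_invariants lam b lam' b' (f : L q t lam b -> L q t lam b -> C)
    (f' : L q t lam' b' -> L q t lam' b' -> C) :
  unitarily_equivalent (@L_act R q t lam b) f (@L_act R q t lam' b') f' ->
  lam = lam' /\ exists n : int, [/\ b' = b + 2 * n%:~R,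
    n < 0 -> nf lam (b - 2) <> 0, 0 < n -> nf lam b <> 0,
    0 < n -> nf lam' (b' - 2) <> 0 & n < 0 -> nf lam' b' <> 0].
Proof.
move=> [phi [psi psiK phiK] [phi_act _]].
have cas l1 c1 := @L_casimir R q a t l1 c1 q_gt0 q_lt1 ta.
have phi_neq0 v : v != 0 -> phi v != 0.
  by apply: contra_neq => h; rewrite -[v]psiK h -(linear0 phi) psiK.
have one0 := @one_neq0 R q a t lam b q_gt0 q_lt1 ta.
have one0' := @one_neq0 R q a t lam' b' q_gt0 q_lt1 ta.
have phi1 := phi_neq0 _ one0.
split.
  have := phi_act uO (L_one q t lam b); rewrite cas cas linearZZ => /eqP.
  by rewrite -subr_eq0 -scalerBl scaler_eq0 (negPf phi1) orbF subr_eq0 => /eqP/complexI.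
have wt_of (l1 c1 c2 : R) (x : L q t l1 c1) : x != 0 -> wt (act := @L_act R q t l1 c1) c2 x ->
    exists n : int, c2 = c1 + 2 * n%:~R /\ L_vec q t l1 c1 n != 0.
  rewrite /wt ubE => x0 xw; have [n [c [h en _]]] := L_eigenvector q_gt0 q_lt1 ta xw x0.
  by exists n; split=> //; move: h => /complexI/(qnum_inj q_gt0 q_lt1).
have [n [bn en]] : exists n : int, b' = b + 2 * n%:~R /\ L_vec q t lam b n != 0.
  apply: (wt_of _ _ _ (psi (L_one q t lam' b'))).
    apply: contra_neq one0' => h.
    exact: etrans (esym (phiK _)) (etrans (congr1 phi h) (linear0 phi)).
  apply: (can_inj psiK).
  have e1 := etrans (phi_act ub _) (congr1 (L_act ub) (phiK (L_one q t lam' b'))).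
  have e2 := etrans (linearZZ phi (qnum q b')%:C _)
    (congr1 ( *:%R (qnum q b')%:C) (phiK (L_one q t lam' b'))).
  exact: etrans e1 (etrans (@L_one_wt R q a t lam' b' q_gt0 q_lt1 ta) (esym e2)).
have [n' [bn' en']] : exists n : int, b = b' + 2 * n%:~R /\ L_vec q t lam' b' n != 0.
  apply: (wt_of _ _ _ (phi (L_one q t lam b)) phi1).
  have e1 := congr1 phi (@L_one_wt R q a t lam b q_gt0 q_lt1 ta).
  exact: etrans (esym (phi_act ub _)) (etrans e1 (linearZZ phi _ _)).
have nn' : n' = - n.
  by clear -bn bn'; apply: (@intr_inj R); rewrite rmorphN /=; lra.
have [h1 h2] := L_vec_neq0 q_gt0 q_lt1 ta en; have [h3 h4] := L_vec_neq0 q_gt0 q_lt1 ta en'.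
exists n; split=> // hn; first by apply: h4; rewrite nn' oppr_lt0.
by apply: h3; rewrite nn' oppr_gt0.
Qed.

End Classification.

Theorem theorem3p17 (R : realType) (q a t : R)
  (hq0 : 0 < q) (hq1 : q < 1) (ht : t = q `^ a - q `^ (- a)) :
  [/\ forall l : label R, label_valid q a l ->
        exists2 ip : {dot (L q t (label_lambda q a l) (label_b a l)) for Num.conj},
          SL2_admissible_irreducible_star_rep a
            (@L_act R q t (label_lambda q a l) (label_b a l)) ip &
          forall u v, ip u v = L_form u v,
      forall (V : lmodType R[i]) (act : U q t -> V -> V) (ip : {dot V for Num.conj}),
        SL2_admissible_irreducible_star_rep a act ip ->
        exists2 l : label R, label_valid q a l &
          unitarily_equivalent act ip
            (@L_act R q t (label_lambda q a l) (label_b a l))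
            (@L_form R q t (label_lambda q a l) (label_b a l))
    & forall l l' : label R, label_valid q a l -> label_valid q a l' ->
        unitarily_equivalent
          (@L_act R q t (label_lambda q a l) (label_b a l))
          (@L_form R q t (label_lambda q a l) (label_b a l))
          (@L_act R q t (label_lambda q a l') (label_b a l'))
          (@L_form R q t (label_lambda q a l') (label_b a l')) ->
        l = l'].
Proof.
split=> [l vl|V act ip [Vmod Vinv adm spec irr]|l l' vl vl'].
- exact: label_rep.
- exact: classification.
- move=> /(equivalent_invariants hq0 hq1 ht)[ll [n [lb h1 h2 h3 h4]]].
  apply: (labels_distinct hq0 hq1 vl vl' ll lb) => hn.
  + by move=> /(lowest_factor0 a hq0); exact: h1.
  + by move=> /(highest_factor0 a hq0); exact: h2.
  + by move=> /(lowest_factor0 a hq0); exact: h3.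
  + by move=> /(highest_factor0 a hq0); exact: h4.
Qed.
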